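(* Let $k\equiv 3\pmod 4$ and $n\ge 2$, and let $c\colon SG_{n,k}\to K_{k+2}$ be the canonical colouring. Then for every automorphism $\gamma$ of $SG_{n,k}$ there is a path in $\mathrm{Hom}(SG_{n,k},K_{k+2})$ from $c$ to $c\circ\gamma$.
   Context: Let $n\ge1$, $k\ge0$, $m=2n+k$. A subset $S\subseteq\{0,\dots,m-1\}$ is stable if $\{i,i+1\}\not\subseteq S$ for all $0\le i\le m-2$ and $\{0,m-1\}\not\subseteq S$. The stable Kneser graph $SG_{n,k}$ has as vertices the stable $n$-element subsets of $\{0,\dots,m-1\}$, two being adjacent iff they are disjoint. $K_{k+2}$ is the loopless complete graph on vertex set $\{0,\dots,k+1\}$. The canonical colouring is $c(S)=\min S$. For graphs $T,G$, $\mathrm{Hom}(T,G)$ is a cell complex whose vertices are the graph homomorphisms $T\to G$, two being joined by an edge if and only if they differ at exactly one vertex of $T$; a path is a path in this complex (equivalently a sequence of homomorphisms in which consecutive ones differ at exactly one vertex). *)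

(* Defs.v *)
From mathcomp Require Import all_boot.
Set Implicit Arguments. Unset Strict Implicit. Unset Printing Implicit Defensive.

Definition ground (n k : nat) := 'I_(2 * n + k).

Definition stable (n k : nat) (S : {set ground n k}) : bool :=
  [forall i : ground n k, forall j : ground n k,
     ((j == i.+1 :> nat) || ((i == 0 :> nat) && (j == (2 * n + k).-1 :> nat)))
       ==> ~~ ((i \in S) && (j \in S))].

Definition SGvert (n k : nat) : finType :=
  {S : {set ground n k} | stable S && (#|S| == n)}.

Definition SGadj (n k : nat) (S T : SGvert n k) : bool :=
  [disjoint (val S) & (val T)].

Definition colouring (n k : nat) := SGvert n k -> 'I_k.+2.

Definition is_hom (n k : nat) (f : colouring n k) : Prop :=
  forall S T : SGvert n k, SGadj S T -> f S <> f T.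

(* minimum of a set of naturals in {0..m-1} (value m for the empty set). *)
Definition minset (n k : nat) (S : {set ground n k}) : nat :=
  \big[minn/(2 * n + k)]_(i in S) (nat_of_ord i).

(* Canonical colouring c(S) = min S.  (min S <= k+1 always holds for stable
   n-subsets, so inord is just the cast to 'I_(k+2).) *)
Definition canonical (n k : nat) : colouring n k :=
  fun S => inord (minset (val S)).

(* Edge of Hom(T,G): differ at exactly one vertex. *)
Definition differ_at_one (n k : nat) (f g : colouring n k) : Prop :=
  exists v : SGvert n k, f v <> g v /\ forall w, w <> v -> f w = g w.

Inductive hom_path (n k : nat) : colouring n k -> colouring n k -> Prop :=
| hom_path_refl f : is_hom f -> hom_path f f
| hom_path_step f g h : is_hom f -> differ_at_one f g -> hom_path g h ->
    hom_path f h.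

Definition is_automorphism (n k : nat) (gamma : SGvert n k -> SGvert n k) : Prop :=
  bijective gamma /\ forall S T, SGadj (gamma S) (gamma T) = SGadj S T.

(* Main.v *)
Require Import Defs.
From mathcomp Require Import all_boot.
From mathcomp Require Import all_fingroup zify.
From Stdlib Require Import FunctionalExtensionality.

(* If every colour i is given an intersecting family F i, all colourings
   choosing for each S a colour i with S in F i lie in one cell of Hom, so two
   of them are joined by a path.  With families that are mostly stars this
   joins c to s o c for the 3-cycle s of the last three colours, and joins
   c to (z o c) precomposed with the rotation, where z is the cyclic shift of
   the colours.  Hence the s with c ~ s o c form a group normalised by z, which
   contains all even permutations.  For k = 3 mod 4 both z and the reversal of
   the k+2 colours are even, which settles the rotation and a reflection of the
   m-cycle.

   Every automorphism is dihedral.  The pairs {S, T} closed under double common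
   neighbourhoods are exactly those where T moves one element of S by one step
   (a flip).  The vertices with at most two flips are the chains
   {a, a+2, .., a+2n-2}; their disjointness relation determines their cyclic
   order, so after a dihedral correction all chains are fixed.  In a square of
   flips, opposite flips happen at the same place, which propagates the
   fixedness from the chains to all vertices. *)

Set Implicit Arguments. Unset Strict Implicit. Unset Printing Implicit Defensive.

(** * Paths of colourings *)

Section Paths.
Variables n k : nat.
Implicit Types f g h : colouring n k.

Lemma hom_path_is_hom f g : hom_path f g -> is_hom f /\ is_hom g.
Proof. by elim=> [|? ? ? ? ? _ []]. Qed.

Lemma hom_path_trans f g h : hom_path f g -> hom_path g h -> hom_path f h.
Proof. by elim=> // f1 f2 f3 hf d _ IH /IH; apply: hom_path_step. Qed.

Lemma hom_path_sym f g : hom_path f g -> hom_path g f.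
Proof.
elim=> [f1|f1 f2 f3 hf [v [vN vE]] p IH]; first exact: hom_path_refl.
apply: hom_path_trans IH _; have [h2 _] := hom_path_is_hom p.
apply: hom_path_step h2 _ (hom_path_refl hf).
by exists v; split=> [/esym|w /vE ->].
Qed.

Lemma hom_path_perm (s : {perm 'I_k.+2}) f g :
  hom_path f g -> hom_path (s \o f) (s \o g).
Proof.
have hS f1 : is_hom f1 -> is_hom (s \o f1) by move=> h S T /h ne /perm_inj.
elim=> [f1 /hS|f1 f2 f3 /hS hf [v [vN vE]] _]; first exact: hom_path_refl.
apply: hom_path_step => //; exists v; split=> [/perm_inj //|w /vE /= ->] //.
Qed.

Lemma hom_path_aut (gamma : SGvert n k -> SGvert n k) f g :
  is_automorphism gamma -> hom_path f g -> hom_path (f \o gamma) (g \o gamma).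
Proof.
move=> [[d gK dK] ga].
have hS f1 : is_hom f1 -> is_hom (f1 \o gamma) by move=> h S T; rewrite -ga => /h.
elim=> [f1 /hS|f1 f2 f3 /hS hf [v [vN vE]] _]; first exact: hom_path_refl.
apply: hom_path_step => //; exists (d v); split=> /= [|w wN]; first by rewrite dK.
by apply: vE => e; apply: wN; rewrite -e gK.
Qed.

(* The colourings choosing colours from prescribed intersecting families form
   a product cell of Hom. *)
Lemma cell_path (F : 'I_k.+2 -> SGvert n k -> Prop) f g :
    (forall i S T, F i S -> F i T -> ~~ SGadj S T) ->
    (forall S, F (f S) S) -> (forall S, F (g S) S) ->
  hom_path f g.
Proof.
move=> FI; have homF f1 : (forall S, F (f1 S) S) -> is_hom f1.
  by move=> h S T + e; apply/negP; apply: FI (h S) _; rewrite e.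
move: {2}#|_|.+1 (ltnSn #|[set S | f S != g S]|) => N.
elim: N f => // N IH f; rewrite ltnS => leN Ff Fg.
have [/eqP|[v]] := set_0Vmem [set S | f S != g S].
  rewrite -subset0 => /subsetP e; have -> : f = g.
    apply: functional_extensionality => S; apply/eqP.
    by apply: contraT => neS; have := e S; rewrite !inE neS => /(_ isT).
  exact/hom_path_refl/homF.
(* Membership in the cell is tested vertex by vertex, so recolouring v alone stays inside. *)
rewrite inE => neq; pose f' S := if S == v then g v else f S.
apply: (@hom_path_step _ _ _ f'); first exact: homF.
  exists v; rewrite /f' eqxx; split; first exact/eqP.
  by move=> w /eqP/negPf ->.
apply: IH => // [|S]; last by rewrite /f'; case: eqP => [->|].
apply: leq_trans leN; apply: proper_card; apply/properP; split.
  by apply/subsetP => S; rewrite !inE /f'; case: (S =P v) => // ->; rewrite eqxx.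
by exists v; rewrite inE // /f' !eqxx.
Qed.

End Paths.

(** * Even permutations from products of two adjacent transpositions *)

Section EvenPerms.
Variables (k : nat) (G : {perm 'I_k.+2} -> Prop).
Hypotheses (G1 : G 1%g) (GM : forall s t, G s -> G t -> G (s * t)%g)
  (GV : forall s, G s -> G s^-1%g).

Definition adj_tperm (i : nat) : {perm 'I_k.+2} := tperm (inord i) (inord i.+1).

Hypothesis Gadj : forall i, i < k -> G (adj_tperm i * adj_tperm i.+1)%g.

Lemma adj_tpermK i : (adj_tperm i * adj_tperm i = 1)%g.
Proof. exact: tperm2. Qed.

(** Telescoping: s_0 s_j times s_j s_(j+1) is s_0 s_(j+1), and s_i s_j is the inverse of s_0 s_i
    times s_0 s_j. *)
Lemma adj_tpermM_closed i j : i <= k -> j <= k -> G (adj_tperm i * adj_tperm j)%g.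
Proof.
have G0 j' : j' <= k -> G (adj_tperm 0 * adj_tperm j')%g.
  elim: j' => [|j' IH] lej; first by rewrite adj_tpermK.
  have := GM (IH (ltnW lej)) (Gadj lej).
  by rewrite mulgA -(mulgA (adj_tperm 0)) adj_tpermK mulg1.
move=> /G0/GV gi /G0 gj; have := GM gi gj.
by rewrite invMg !tpermV mulgA -(mulgA (adj_tperm i)) adj_tpermK mulg1.
Qed.

Definition adj_word (s : {perm 'I_k.+2}) : Prop :=
  exists2 w : seq nat, all (leq^~ k) w & s = (\prod_(i <- w) adj_tperm i)%g.

Lemma adj_wordM s t : adj_word s -> adj_word t -> adj_word (s * t)%g.
Proof.
by move=> [w hw ->] [v hv ->]; exists (w ++ v); rewrite ?all_cat ?hw ?big_cat.
Qed.

(** Induction on the distance: conjugation by [adj_tperm (i + d)] moves the far end from i + d to i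
    + d + 1. *)
Lemma adj_word_tperm x y : adj_word (tperm x y).
Proof.
have gen d : forall i, i + d <= k.+1 -> adj_word (tperm (inord i) (inord (i + d))).
  elim: d => [|d IH] i le_id.
    by exists [::] => //; rewrite big_nil addn0 tperm1.
  have [->|d_gt0] := posnP d.
    by exists [:: i]; rewrite ?big_seq1 ?addn1 //=; lia.
  rewrite addnS in le_id *.
  have ad : adj_word (adj_tperm (i + d)).
    by exists [:: i + d]; rewrite ?big_seq1 //=; lia.
  have -> : tperm (inord i) (inord (i + d).+1)
     = (adj_tperm (i + d) * tperm (inord i) (inord (i + d)) * adj_tperm (i + d))%g.
    rewrite -mulgA -{1}[adj_tperm _]tpermV -/(conjg _ _) tpermJ tpermL tpermD //.
      by apply/eqP => /(congr1 val); rewrite /= !inordK; lia.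
    by apply/eqP => /(congr1 val); rewrite /= !inordK; lia.
  by apply: adj_wordM => //; apply: adj_wordM => //; apply: IH; lia.
wlog le_xy : x y / x <= y.
  by move=> W; have [/W//|/ltnW/W] := leqP x y; rewrite tpermC.
by have := gen (y - x) x; rewrite subnKC // !inord_val; apply; case: y {le_xy}.
Qed.

(** A word of adjacent transpositions for an even s has even length, so its letters can be consumed
    in pairs. *)
Lemma even_perm_closed s : ~~ odd_perm s -> G s.
Proof.
have [w hw ->] : adj_word s.
  have [ts -> _] := prod_tpermP s.
  elim: ts => [|[x y] ts IH]; first by exists [::]; rewrite ?big_nil.
  by rewrite big_cons; apply: adj_wordM IH; apply: adj_word_tperm.
move: {2}(size w) (leqnn (size w)) hw => N; elim: N w => [|N IH] [|i [|j w]] //=;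
  rewrite ?big_nil //.
- move=> _ /andP[hi _]; rewrite big_seq1 odd_tperm.
  by case: eqP => // /(congr1 val); rewrite /= !inordK //; lia.
- move=> lew /and3P[hi hj hw]; rewrite !big_cons mulgA => ev.
  apply: GM; first exact: adj_tpermM_closed.
  apply: IH => //; first by rewrite ltnW.
  move: ev; rewrite !odd_permM !odd_tperm.
  have neq l : l <= k -> (inord l != inord l.+1 :> 'I_k.+2).
    by move=> hl; apply/eqP => /(congr1 val); rewrite /= !inordK //; lia.
  by rewrite !neq //=.
Qed.

End EvenPerms.

(** Reversal of m + 1 points is reversal of m points lifted by 0 -> m; the lift contributes the
    parity of m, as in Pascal's rule. *)
Lemma odd_perm_rev_ord m : odd_perm (perm (@rev_ord_inj m)) = odd 'C(m, 2).
Proof.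
elim: m => [|m IH].
  by rewrite (_ : perm _ = 1%g) ?odd_perm1 //; apply/permP => -[].
have -> : perm (@rev_ord_inj m.+1) = lift_perm ord0 ord_max (perm (@rev_ord_inj m)).
  apply/permP => x; rewrite permE; case: (unliftP ord0 x) => [j ->|->].
    rewrite lift_perm_lift permE; apply: val_inj => /=.
    by rewrite /bump /=; have := ltn_ord j; lia.
  by rewrite lift_perm_id; apply: val_inj => /=; rewrite subn1.
by rewrite odd_lift_perm IH binS bin1 oddD /= addbC.
Qed.

(** * Stable sets *)

Section Cyclic.
Variables n k : nat.
Local Notation m := (2 * n + k).
Implicit Types (S T U : SGvert n k) (x y z : ground n k).

Lemma ordS_spec x :
  (x.+1 < m /\ ordS x = x.+1 :> nat) \/ (x.+1 = m /\ ordS x = 0 :> nat).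
Proof.
rewrite /=; have := ltn_ord x; rewrite leq_eqVlt => /orP[/eqP->|lt_xm].
  by right; rewrite modnn.
by left; rewrite modn_small.
Qed.

Lemma ord_pred_spec x :
  (0 < x /\ ord_pred x = x.-1 :> nat) \/ (x = 0 :> nat /\ ord_pred x = m.-1 :> nat).
Proof.
have := ordS_spec (ord_pred x); rewrite ord_predK; have := ltn_ord x.
by have := ltn_ord (ord_pred x); lia.
Qed.

(** The cyclic successor absorbs the wrap-around pair, so stability becomes one rotation-invariant
    condition. *)
Lemma stableP (X : {set ground n k}) :
  reflect (forall x, x \in X -> ordS x \notin X) (stable X).
Proof.
apply: (iffP forallP) => [h x xX|h i].
  have := ordS_spec x => -[[_ e]|[em e0]].
    have /forallP/(_ (ordS x)) := h x.
    by rewrite e eqxx /= xX.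
  have /forallP/(_ x) := h (ordS x).
  by rewrite e0 -[X in X.-1]em /= !eqxx orbT xX andbT.
apply/forallP => j; apply/implyP => hij; apply/negP => /andP[iX jX].
have /orP[/eqP ej|/andP[/eqP ei /eqP ej]] := hij.
  have := h i iX; rewrite (_ : ordS i = j) ?jX //; apply: ord_inj.
  by have := ordS_spec i; have := ltn_ord j; lia.
have := h j jX; rewrite (_ : ordS j = i) ?iX //; apply: ord_inj.
by have := ordS_spec j; have := ltn_ord j; lia.
Qed.

Lemma vert_stable S x : x \in val S -> ordS x \notin val S.
Proof. by case/andP: (valP S) => /stableP h _; apply: h. Qed.

Lemma vert_stable_pred S x : x \in val S -> ord_pred x \notin val S.
Proof. by apply: contraL => /vert_stable; rewrite ord_predK. Qed.

Lemma card_vert S : #|val S| = n.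
Proof. by case/andP: (valP S) => _ /eqP. Qed.

Lemma vert_exists (X : {set ground n k}) :
  (forall x, x \in X -> ordS x \notin X) -> #|X| = n -> exists S, val S = X.
Proof.
move=> /stableP sX cX; have h : stable X && (#|X| == n) by rewrite sX cX eqxx.
by exists (exist _ X h).
Qed.

(** Membership at a plain number, so that colours and sums such as [o + 3] serve as points without a
    bound proof. *)
Definition hits S (i : nat) := [exists x in val S, x == i :> nat].

Lemma hitsP S i : reflect (exists2 x, x \in val S & x = i :> nat) (hits S i).
Proof.
apply: (iffP existsP) => -[x]; first by case/andP=> xS /eqP; exists x.
by move=> xS /eqP e; exists x; rewrite xS.
Qed.

Lemma hits_val S x : hits S x = (x \in val S).
Proof.
apply/hitsP/idP => [[y yS /ord_inj <-]|xS] //.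
by exists x.
Qed.

Lemma hits_lt S i : hits S i -> i < m.
Proof. by case/hitsP=> x _ <-. Qed.

Lemma hitsS S i : hits S i -> hits S i.+1 -> False.
Proof.
case/hitsP=> x xS <- /hitsP[y yS e].
have := vert_stable xS; rewrite (_ : ordS x = y) ?yS //; apply: ord_inj.
by have := ordS_spec x; have := ltn_ord y; lia.
Qed.

Lemma hits_adj S T i : hits S i -> hits T i -> ~~ SGadj S T.
Proof.
case/hitsP=> x xS <-; rewrite hits_val => xT.
by apply/negP => /disjointFr /(_ xS); rewrite xT.
Qed.

(** Pigeonhole, used with p = n - 1 for contradictions; injectivity is asked for i < j only, where
    stability gives j >= i + 2. *)
Lemma card_vert_le S (f : nat -> nat) p :
    (forall i, hits S i -> f i < p) ->
    (forall i j, hits S i -> hits S j -> i < j -> f i <> f j) ->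
  n <= p.
Proof.
move=> fp finj; rewrite -(card_vert S) cardE -(size_map (fun x => f x)) -(size_iota 0 p).
apply: uniq_leq_size => [|_ /mapP[x + ->]]; last first.
  by rewrite mem_enum -hits_val mem_iota add0n => /fp.
rewrite map_inj_in_uniq ?enum_uniq // => x y; rewrite !mem_enum -!hits_val => xS yS e.
apply: ord_inj; case: (ltngtP x y) => // /finj h; first by case: (h xS yS).
by case: (h yS xS).
Qed.

(** Beyond the first five points at most 2n - 4 remain; they split into n - 2 adjacent pairs, each
    holding at most one element. A lone element among the five would get slot n - 2, making n - 1
    slots in all. *)
Lemma two_of_five S o : 0 < o -> n + n + k <= o + (2 * n).+1 -> 1 < n ->
    (forall i, i < o -> ~~ hits S i) ->
  exists i j, [/\ hits S i, hits S j, o <= i, i < j & j < o + 5].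
Proof.
move=> o_gt0 leo n_gt1 noS.
have [/existsP[x /existsP[y /and3P[]]]|] := boolP [exists x : ground n k,
  [exists y : ground n k, [&& hits S x, hits S y & (x < y) && (y < o + 5)]]].
  move=> xS yS /andP[xy yo]; exists x, y; split=> //.
  by rewrite leqNgt; apply/negP => /noS; rewrite xS.
move=> none; suff: n <= n.-1 by lia.
apply: (@card_vert_le S (fun i => if i < o + 5 then n - 2 else (i - (o + 5))./2)).
  by move=> i Si; have := hits_lt Si; case: ifP; lia.
move=> i j Si Sj ij; case: (ltnP j (o + 5)) => [jo _|oj].
  move: none; rewrite negb_exists => /forallP/(_ (Ordinal (hits_lt Si))).
  rewrite negb_exists => /forallP/(_ (Ordinal (hits_lt Sj))) /=.
  by rewrite Si Sj ij jo.
have jm := hits_lt Sj.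
case: ifP => // io; first by lia.
have : j <> i.+1 by move=> e; rewrite e in Sj; case: (hitsS Si Sj).
by lia.
Qed.

Lemma hits_min S : 0 < n ->
  exists2 i, hits S i & [/\ forall j, hits S j -> i <= j & canonical S = inord i].
Proof.
move=> n_gt0.
have [x0 x0S] : exists x, x \in val S.
  by apply/set0Pn; rewrite -card_gt0 card_vert.
have [x xS xmin] := arg_minnP (fun x : ground n k => nat_of_ord x) x0S.
exists x; first by rewrite hits_val.
split=> [j /hitsP[y yS <-]|]; first exact: xmin.
congr inord; apply/eqP; rewrite eqn_leq; apply/andP; split.
  rewrite /Defs.minset -big_filter; have : x \in [seq i <- index_enum _ | i \in val S].
    by rewrite mem_filter mem_index_enum andbT.
  elim: (filter _ _) => // y s IH; rewrite inE big_cons geq_min.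
  by case/predU1P=> [->|/IH ->]; rewrite ?leqnn ?orbT.
apply: (big_ind (fun i => x <= i)); first exact: ltnW (ltn_ord x).
  by move=> i j xi xj; rewrite leq_min xi.
by move=> y /xmin.
Qed.

(** S lies in the 2n - 1 points k + 1, .., m - 1. Without either end, the other 2n - 2 points form n
    - 1 adjacent pairs, too few for n elements. *)
Lemma hits_last S : 0 < n -> (forall i, i <= k -> ~~ hits S i) ->
  hits S k.+1 /\ hits S m.-1.
Proof.
move=> n_gt0 noS.
have gt_k i : hits S i -> k < i.
  by move=> Si; rewrite ltnNge; apply/negP => /noS; rewrite Si.
(* [d] tells which end is missing: k + 1 for [true], m - 1 for [false]. *)
have key (d : bool) : (forall i, hits S i -> k + d < i < m.-1 + d) -> False.
  move=> hd; suff: n <= n.-1 by lia.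
  apply: (@card_vert_le S (fun i => (i - (k + d).+1)./2)) => [i Si|i j Si Sj ij].
    by have := hd i Si; lia.
  have : j <> i.+1 by move=> e; rewrite e in Sj; case: (hitsS Si Sj).
  by have := hd i Si; have := hd j Sj; lia.
split; apply: contraT => no.
  case: (key true) => i Si; have := gt_k i Si; have := hits_lt Si.
  have : i <> k.+1 by move=> e; rewrite -e Si in no.
  by lia.
case: (key false) => i Si; have := gt_k i Si; have := hits_lt Si.
have : i <> m.-1 by move=> e; rewrite -e Si in no.
by lia.
Qed.

End Cyclic.

(** * A three-cycle of colours *)

Section ThreeCycle.
Variables n k : nat.
Hypotheses (n_gt1 : 1 < n) (k_gt1 : 1 < k).
Local Notation m := (2 * n + k).
Local Notation o := k.-1.
Implicit Types (S T : SGvert n k) (q : nat -> SGvert n k -> Prop) (r : SGvert n k -> nat).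

(** The vertices with minimum at least k - 1, the only ones recoloured along the path. *)
Definition high S := forall i, i < o -> ~~ hits S i.

(** Colours below k - 1 keep their stars; [q j] is the family of the colour k - 1 + j. *)
Definition in_cell q (f : colouring n k) :=
  forall S, if f S < o then hits S (f S) : Prop else q (f S - o) S.

Lemma high_cell_path q (f g : colouring n k) :
    (forall j S T, q j S -> q j T -> ~~ SGadj S T) ->
  in_cell q f -> in_cell q g -> hom_path f g.
Proof.
move=> qI qf qg.
apply: (@cell_path _ _ (fun i S => if i < o then hits S i : Prop else q (i - o) S)) => //.
move=> i S T; case: ifP => _; [exact: hits_adj|exact: qI].
Qed.

Definition high_col r : colouring n k := fun S =>
  if canonical S < o then canonical S else inord (o + r S).

Lemma canonical_low S : let c := canonical S in
  (c < o /\ hits S c) \/ [/\ o <= c, high S & exists2 i, i <= k.+1 & 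
     [/\ c = i :> nat, hits S i & forall j, hits S j -> i <= j]].
Proof.
have [i Si [imin ->] /=] := @hits_min n k S (ltnW n_gt1).
have ik : i <= k.+1.
  rewrite leqNgt; apply/negP => ki; have [|/imin h _] := @hits_last n k S (ltnW n_gt1).
    by move=> j jk; apply/negP => /imin; lia.
  by lia.
have -> : (inord i : 'I_k.+2) = i :> nat by rewrite inordK.
have [io|oi] := ltnP i o; first by left.
right; split=> //; last by exists i.
by move=> j jo; apply/negP => /imin; lia.
Qed.

Lemma high_col_in_cell q r :
    (forall S, high S -> r S <= 2) -> (forall S, high S -> q (r S) S) ->
  in_cell q (high_col r).
Proof.
move=> r2 qr S; rewrite /high_col; have [[lo hc]|[oc hS _]] := canonical_low S.
  by rewrite lo lo.
have -> : (canonical S < o) = false by rewrite ltnNge oc.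
rewrite inordK; last by have := r2 S hS; lia.
by rewrite ltnNge leq_addr /= addKn; apply: qr.
Qed.

(** The one family that is not a star: what the stars at k and k + 2 leave over among the high
    vertices. *)
Definition no13 S := [/\ high S, ~~ hits S (o + 1) & ~~ hits S (o + 3)].

(* Only 2n-1 points remain, so two disjoint n-sets do not fit. *)
Lemma no13_adj S T : no13 S -> no13 T -> ~~ SGadj S T.
Proof.
move=> [hS S1 S3] [hT T1 T3]; apply/negP => adjST.
have cU : #|val S :|: val T| = 2 * n.
  by rewrite cardsU disjoint_setI0 // cards0 !card_vert; lia.
(* Renumbers o, o + 2, o + 4, o + 5, .. as 0, 1, 2, 3, ..; there are m - o - 2 = 2n - 1 of them. *)
pose f (x : nat) := if x == o then 0 else if x == o + 2 then 1 else x - o - 2.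
have nU x : x \in val S :|: val T -> [/\ o <= x, x <> o + 1 :> nat & x <> o + 3 :> nat].
  rewrite inE -!hits_val => /orP[]h.
    split; last 2 first.
    - by move=> e; move: S1; rewrite -e h.
    - by move=> e; move: S3; rewrite -e h.
    by rewrite leqNgt; apply/negP => /hS; rewrite h.
  split; last 2 first.
  - by move=> e; move: T1; rewrite -e h.
  - by move=> e; move: T3; rewrite -e h.
  by rewrite leqNgt; apply/negP => /hT; rewrite h.
suff : 2 * n <= (2 * n).-1 by lia.
rewrite -{1}cU cardE -(size_map (fun x : ground n k => f x)) -(size_iota 0 (2 * n).-1).
apply: uniq_leq_size => [|_ /mapP[x + ->]]; last first.
  rewrite mem_enum mem_iota add0n /f => /nU[? ? ?]; have := ltn_ord x.
  by do 2?[case: ifP]; lia.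
rewrite map_inj_in_uniq ?enum_uniq // => x y; rewrite !mem_enum /f.
move=> /nU[? ? ?] /nU[? ? ?] e; apply: ord_inj; move: e.
by do 4?[case: ifP]; lia.
Qed.

Definition star3 (a b c j : nat) S :=
  hits S (o + (if j is 0 then a else if j is 1 then b else c)).

Definition star2 (a b j : nat) S :=
  match j with 0 => hits S (o + a) : Prop | 1 => hits S (o + b) | _ => no13 S end.

Lemma star3_adj a b c j S T : star3 a b c j S -> star3 a b c j T -> ~~ SGadj S T.
Proof. exact: hits_adj. Qed.

Lemma star2_adj a b j S T : star2 a b j S -> star2 a b j T -> ~~ SGadj S T.
Proof. by case: j => [|[|j]] /=; [exact: hits_adj|exact: hits_adj|exact: no13_adj]. Qed.

(** The six non-adjacent pairs among five consecutive points, in the form needed for the truth table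
    of [case_high]. *)
Lemma high_two S : high S ->
  [|| hits S (o + 0) && hits S (o + 2), hits S (o + 0) && hits S (o + 3),
      hits S (o + 0) && hits S (o + 4), hits S (o + 1) && hits S (o + 3),
      hits S (o + 1) && hits S (o + 4) | hits S (o + 2) && hits S (o + 4)].
Proof.
move=> hS; have [||i [j [Si Sj oi ij jo]]] := @two_of_five n k S o _ _ n_gt1 hS.
- by lia.
- by lia.
have : j <> i.+1 by move=> e; rewrite e in Sj; case: (hitsS Si Sj).
have [a ei] : exists a, i = o + a by exists (i - o); lia.
have [b ej] : exists b, j = o + b by exists (j - o); lia.
subst i j; have {jo} b5 : b < 5 by lia.
have {ij} ab : a < b by lia.
by clear oi; move: a b b5 ab Si Sj => [|[|[|[|a]]]] [|[|[|[|[|b]]]]] // _ _ -> -> {hS};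
  rewrite ?orbT //; lia.
Qed.

Lemma hits_apart S a : ~~ (hits S (o + a) && hits S (o + a.+1)).
Proof. by apply/negP => /andP[h]; rewrite addnS => /(hitsS h). Qed.

Local Ltac case_high S hS :=
  move: (high_two hS) (hits_apart S 0) (hits_apart S 1) (hits_apart S 2) (hits_apart S 3);
  rewrite /star2 /star3 /no13;
  do 5?[match goal with |- context [hits S ?i] => destruct (hits S i) eqn:? end];
  rewrite //=;
  repeat match goal with e : hits S _ = _ |- _ => rewrite ?e; clear e end; by split.

(* Writing a for the point k-1+a, the families of the colours k-1, k, k+1 are
   successively (0, 1, no13), (3, 1, no13), (3, 4, no13), (3, 4, 0), (1, 4, 0),
   a number standing for its star; the other colours keep their stars. *)
Lemma three_cycle_path :
  hom_path (@canonical n k)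
    ((adj_tperm k k.-1 * adj_tperm k k)%g \o @canonical n k).
Proof.
(* Each [r] is a choice of colours valid in two consecutive cells, which links them. *)
pose r1 S := if hits S (o + 1) then 1 else if hits S (o + 3) then 0 else 2.
pose r2 S := if hits S (o + 3) then 0 else if hits S (o + 1) then 1 else 2.
pose r3 S := if hits S (o + 3) then 0 else if hits S (o + 4) then 1 else 2.
pose r4 S := if hits S (o + 0) then 2 else if hits S (o + 4) then 1 else 0.
apply: (@hom_path_trans _ _ _ (high_col r1)).
  apply: (high_cell_path (@star2_adj 0 1)).
    move=> S; have [[lo Sc]|[oc hS [i ik [ec Si imin]]]] := canonical_low S.
      by rewrite lo.
    rewrite ec in oc *; rewrite ltnNge oc /=.
    have [a ea] : exists a, i = o + a by exists (i - o); lia.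
    have a2 : a <= 2 by lia.
    rewrite ea addKn; move: a a2 ea Si => [|[|[|a]]] // _ ea Si; rewrite ea in Si.
    - exact: Si.
    - exact: Si.
    - split=> //; last by have := hits_apart S 2; rewrite Si.
      by apply/negP => /imin; lia.
  by apply: high_col_in_cell => S hS; rewrite /r1; case_high S hS.
apply: (@hom_path_trans _ _ _ (high_col r2)).
  by apply: (high_cell_path (@star2_adj 3 1)); apply: high_col_in_cell => S hS;
    rewrite /r1 /r2; case_high S hS.
apply: (@hom_path_trans _ _ _ (high_col r3)).
  by apply: (high_cell_path (@star2_adj 3 4)); apply: high_col_in_cell => S hS;
    rewrite /r2 /r3; case_high S hS.
apply: (@hom_path_trans _ _ _ (high_col r4)).
  by apply: (high_cell_path (@star3_adj 3 4 0)); apply: high_col_in_cell => S hS;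
    rewrite /r3 /r4; case_high S hS.
apply: (high_cell_path (@star3_adj 1 4 0)).
  by apply: high_col_in_cell => S hS; rewrite /r4; case_high S hS.
(* The 3-cycle sends k-1, k, k+1 to k+1, k-1, k. Minima k-1 and k give the stars numbered 0 and 1; a
   high set with minimum k+1 contains k+3 by [high_two], which gives star 4. *)
move=> S; rewrite /= permM; set c := canonical S.
have val_inord j : j <= k.+1 -> (inord j : 'I_k.+2) = j :> nat by move=> ?; rewrite inordK.
have ne (x y : 'I_k.+2) : x <> y :> nat -> x != y by move=> h; apply/eqP => e; rewrite e in h.
have := canonical_low S; rewrite -/c /= => -[[lo Sc]|[oc hS [i ik [ec Si imin]]]].
  have fixc j : k.-1 <= j <= k -> adj_tperm k j c = c.
    by move=> hj; rewrite tpermD //; apply: ne; rewrite val_inord; lia.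
  have k_ok : k.-1 <= k <= k by lia.
  by rewrite (fixc k.-1) ?(fixc k) ?lo ?leqnn ?leq_pred.
have k1 : k.-1.+1 = k by lia.
have oi : o <= i by rewrite -ec.
have -> : c = inord i by apply: ord_inj; rewrite val_inord.
have [ei|[ei|ei]] : i = k.-1 \/ i = k \/ i = k.+1 by lia.
- rewrite ei /adj_tperm k1 !tpermL val_inord // ifN; last by lia.
  rewrite (_ : k.+1 - o = 2); last by lia.
  by rewrite /star3 addn0 -ei.
- rewrite ei /adj_tperm k1 tpermR tpermD; try by apply: ne; rewrite !val_inord; lia.
  rewrite val_inord ?ltnn ?subnn; last by lia.
  by rewrite ei in Si; rewrite /star3 (_ : o + 1 = k) //; lia.
- rewrite ei /adj_tperm k1 [tperm (inord k.-1) _ _]tpermD; try by apply: ne; rewrite !val_inord; lia.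
  rewrite tpermR val_inord // ifN; last by lia.
  rewrite (_ : k - o = 1); last by lia.
  have lt2 j : hits S (o + j) -> 2 <= j by move=> /imin; lia.
  by case/orP: (high_two hS) => [/andP[/lt2]//|]; do !case/orP => [/andP[/lt2]//|] //; case/andP.
Qed.

End ThreeCycle.

(** * Rotation and reflection *)

Section Dihedral.
Variables n k : nat.
Local Notation m := (2 * n + k).
Implicit Types (S T : SGvert n k) (g : ground n k -> ground n k).

Definition cycle_sym g :=
  injective g /\ ((forall x, g (ordS x) = ordS (g x)) \/
                  (forall x, g (ordS x) = ord_pred (g x))).

(** The default S of [insubd] never arises for a symmetry of the cycle, by [val_move_vert]. *)
Definition move_vert g S : SGvert n k := insubd S (g @: val S).

Lemma val_move_vert g S : cycle_sym g -> val (move_vert g S) = g @: val S.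
Proof.
move=> [gI gS]; rewrite val_insubd card_imset // card_vert eqxx andbT.
case: ifP => // /negP[]; apply/stableP => _ /imsetP[x xS ->]; apply/imsetP => -[y yS e].
case: gS => gS.
  by have := vert_stable xS; rewrite (gI (ordS x) y) ?yS // gS.
by have := vert_stable yS; rewrite (gI (ordS y) x) ?xS // gS -e ordSK.
Qed.

Lemma move_vert_aut g : cycle_sym g -> is_automorphism (move_vert g).
Proof.
move=> gs; have [gI _] := gs; split.
  apply: injF_bij => S T /(congr1 val); rewrite !val_move_vert //.
  by move/(imset_inj gI)/val_inj.
move=> S T; rewrite /SGadj !val_move_vert // -!setI_eq0 -imsetI ?imset_eq0 //.
by move=> x y _ _; apply: gI.
Qed.

Definition rotate : SGvert n k -> SGvert n k := move_vert (@ordS m).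

Lemma ordS_sym : cycle_sym (@ordS m).
Proof. by split; [apply: ordS_inj|left]. Qed.

(** The reflection x -> k + 1 - x modulo m, chosen because it reverses the range 0 .. k + 1 of the
    colours. *)
Definition mirror (x : ground n k) : ground n k :=
  insubd x (if x <= k.+1 then k.+1 - x else m + k.+1 - x).

Hypothesis n_gt1 : 1 < n.

Lemma mirror_val x :
  mirror x = (if x <= k.+1 then k.+1 - x else m + k.+1 - x) :> nat.
Proof. by rewrite val_insubd; have := ltn_ord x; do 2?[case: ifP => //]; lia. Qed.

Lemma mirror_sym : cycle_sym mirror.
Proof.
split=> [x y /(congr1 (@nat_of_ord m)) e|]; last right=> x; apply: ord_inj.
  by move: e; rewrite !mirror_val; have := ltn_ord x; have := ltn_ord y; do 2?[case: ifP]; lia.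
have := ord_pred_spec (mirror x); have := ordS_spec x; rewrite !mirror_val.
by have := ltn_ord x; do 2?[case: ifP]; lia.
Qed.

Lemma hits_rotate S i : hits (rotate S) i ->
  if i is j.+1 then hits S j else hits S m.-1.
Proof.
case/hitsP=> y; rewrite val_move_vert; last exact: ordS_sym.
case/imsetP=> x xS -> <-; have [[_ ->]|[xm ->]] := ordS_spec x; first by rewrite hits_val.
by rewrite -[X in X.-1]xm hits_val.
Qed.

Lemma hits_mirror S i : hits (move_vert mirror S) i -> i <= k.+1 -> hits S (k.+1 - i).
Proof.
case/hitsP=> y; rewrite val_move_vert; last exact: mirror_sym.
case/imsetP=> x xS -> <-; rewrite mirror_val; have := ltn_ord x.
case: ifP => [le_x _ _|_]; last by lia.
by rewrite subKn // hits_val.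
Qed.

(** The last clause offers the colour k + 1 a second star, the one at m - 1, which rotation carries
    to 0. *)
Lemma canonical_spec S :
  exists2 i, i <= k.+1 & [/\ canonical S = inord i, hits S i
    & i = k.+1 -> hits S m.-1].
Proof.
have [i Si [imin ->]] := @hits_min n k S (ltnW n_gt1).
have noS : k < i -> forall j, j <= k -> ~~ hits S j.
  by move=> ki j jk; apply/negP => /imin; lia.
have last : k < i -> i <= k.+1 /\ hits S m.-1.
  by case/noS/(hits_last (ltnW n_gt1)) => /imin.
exists i; first by case: (leqP i k) => [|/last[]]; lia.
by split=> // ei; case: last; rewrite // ei.
Qed.

(** The cycle 0 -> k + 1, i + 1 -> i, written with [lift_perm] so that its sign is immediate. *)
Definition shift_colours : {perm 'I_k.+2} := lift_perm ord0 ord_max 1.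

Lemma shift_colours0 : shift_colours ord0 = ord_max.
Proof. exact: lift_perm_id. Qed.

Lemma shift_coloursS i : i <= k -> shift_colours (inord i.+1) = inord i.
Proof.
move=> ik; rewrite (_ : inord i.+1 = lift ord0 (inord i : 'I_k.+1)).
  rewrite lift_perm_lift perm1; apply: ord_inj.
  by rewrite /= /bump !inordK; lia.
by apply: ord_inj; rewrite /= /bump !inordK; lia.
Qed.

(* Both colourings give the star at i to each colour i <= k, and the star at
   m-1 to colour k+1. *)
Lemma rotate_path :
  hom_path (@canonical n k) (shift_colours \o (@canonical n k \o rotate)).
Proof.
apply: (@cell_path _ _ (fun i S => if i <= k then hits S i : Prop else hits S m.-1)).
- by move=> i S T; case: ifP => _; exact: hits_adj.
- move=> S; have [i ik [-> Si last]] := canonical_spec S.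
  by rewrite inordK //; case: ifP => // ik'; apply: last; lia.
move=> S /=; have [i ik [-> /hits_rotate Si _]] := canonical_spec (rotate S).
case: i ik Si => [|i] ik Si.
  rewrite (_ : inord 0 = ord0) ?shift_colours0 /= ?ltnn //.
  by apply: ord_inj; rewrite inordK.
by rewrite shift_coloursS // inordK ?ifT //; lia.
Qed.

(** Both colourings give the star at k + 1 - i to the colour i. *)
Lemma mirror_path :
  hom_path (perm (@rev_ord_inj k.+2) \o @canonical n k)
    (@canonical n k \o move_vert mirror).
Proof.
apply: (@cell_path _ _ (fun i S => hits S (k.+1 - i))).
- by move=> i S T; exact: hits_adj.
- move=> S; rewrite /= permE; have [i ik [-> Si _]] := canonical_spec S.
  by rewrite /= inordK // subSS subKn.
- move=> S /=; have [i ik [-> Si _]] := canonical_spec (move_vert mirror S).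
  by rewrite inordK //; apply: hits_mirror.
Qed.

Hypothesis k_mod : k %% 4 = 3.

Lemma even_perm_path (s : {perm 'I_k.+2}) :
  ~~ odd_perm s -> hom_path (@canonical n k) (s \o @canonical n k).
Proof.
have k_gt1 : 1 < k by lia.
have c3 := three_cycle_path n_gt1 k_gt1.
have [homc _] := hom_path_is_hom c3.
have compE (s1 t1 : {perm 'I_k.+2}) :
    (s1 * t1)%g \o @canonical n k = t1 \o (s1 \o @canonical n k).
  by apply: functional_extensionality => S /=; rewrite permM.
have comp1 : (1%g : {perm 'I_k.+2}) \o @canonical n k = @canonical n k.
  by apply: functional_extensionality => S /=; rewrite perm1.
apply: (@even_perm_closed k (fun s => hom_path _ (s \o _))) => {s}.
- by rewrite comp1; exact: hom_path_refl.
- move=> s t hs ht; rewrite compE.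
  exact: hom_path_trans ht (hom_path_perm t hs).
- by move=> s /(hom_path_perm s^-1%g); rewrite -compE mulgV comp1; apply: hom_path_sym.
(* Downward induction from i = k - 1, the 3-cycle already obtained. *)
suff descend d : forall i, i + d = k.-1 ->
    hom_path (@canonical n k) ((adj_tperm k i * adj_tperm k i.+1)%g \o @canonical n k).
  by move=> i ik; apply: (descend (k.-1 - i)); lia.
elim: d => [|d IH] i; first by rewrite addn0 => ->; rewrite (_ : k.-1.+1 = k) //; lia.
rewrite addnS => e; have {}IH := IH i.+1 e.
have -> : (adj_tperm k i * adj_tperm k i.+1 =
    (adj_tperm k i.+1 * adj_tperm k i.+2) ^ shift_colours)%g.
  by rewrite conjMg !tpermJ !shift_coloursS //; lia.
set s := (adj_tperm k i.+1 * _)%g in IH *.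
(* As functions, with z the shift and r the rotation: c ~ z c r ~ z s c r = s' z c r ~ s' c, where
   s' = z s z^-1 is the lowered 3-cycle. *)
apply: hom_path_trans rotate_path _.
have /(hom_path_perm shift_colours) h := hom_path_aut (move_vert_aut ordS_sym) IH.
apply: hom_path_trans h _; apply: hom_path_sym.
have := hom_path_perm (s ^ shift_colours)%g rotate_path.
congr hom_path; apply: functional_extensionality => S /=.
by rewrite conjgE !permM permK.
Qed.

(** The shift is a cycle of odd length k + 2, hence even, and can be removed from [rotate_path]. *)
Lemma rotate_good : hom_path (@canonical n k) (@canonical n k \o rotate).
Proof.
apply: hom_path_trans rotate_path _; apply: hom_path_sym.
apply: (hom_path_aut (move_vert_aut ordS_sym) (even_perm_path _)).
by rewrite odd_lift_perm odd_perm1 /=; lia.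
Qed.

Lemma mirror_good : hom_path (@canonical n k) (@canonical n k \o move_vert mirror).
Proof.
apply: hom_path_trans mirror_path; apply: even_perm_path.
rewrite odd_perm_rev_ord bin2.
(* The binomial is (4t + 5)(4t + 4)/2 = 2(t + 1)(4t + 5), so the reversal is even. *)
have [t ->] : exists t, k = 4 * t + 3 by exists (k %/ 4); have := divn_eq k 4; lia.
rewrite (_ : _ * _ = (2 * (t.+1 * (4 * t + 5))).*2); last by rewrite -muln2 /=; nia.
by rewrite doubleK mul2n odd_double.
Qed.

End Dihedral.

(** * Flips and automorphisms *)

Section Flips.
Variables n k : nat.
Hypotheses (n_gt1 : 1 < n) (k_odd : odd k).
Local Notation m := (2 * n + k).
Local Notation V := (SGvert n k).
Local Notation nx := (@ordS m).
Local Notation pv := (@ord_pred m).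
Implicit Types (S T U W : V) (x y z w t : ground n k).

Lemma ordS_neq x : nx x != x.
Proof. by apply/eqP => /(congr1 (@nat_of_ord m)); have := ordS_spec x; lia. Qed.

Lemma ordS2_neq x : nx (nx x) != x.
Proof.
apply/eqP => /(congr1 (@nat_of_ord m)); have := ordS_spec x.
by have := ordS_spec (nx x); lia.
Qed.

Lemma pred_closed_full (A : {set ground n k}) x :
  x \in A -> (forall y, y \in A -> pv y \in A) -> forall y, y \in A.
Proof.
move=> xA Ap.
have below d : forall y z, z \in A -> y + d = z -> y \in A.
  elim: d => [|d IH] y z zA; first by rewrite addn0 => /ord_inj ->.
  move=> e; apply: (IH y (pv z)); first exact: Ap.
  by have := ord_pred_spec z; lia.
have m_gt0 : 0 < m by lia.
have A0 : Ordinal m_gt0 \in A by apply: (below x _ x xA); rewrite add0n.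
move=> y; apply: (below (m.-1 - y) y _ (Ap _ A0)).
by have := ord_pred_spec (Ordinal m_gt0); have := ltn_ord y; rewrite /=; lia.
Qed.

(** The point x can clash only with its two neighbours, and z is removed. *)
Lemma swap_exists S z x : z \in val S -> x \notin val S ->
    (nx x \in val S -> nx x = z) -> (pv x \in val S -> pv x = z) ->
  exists T, val T = x |: (val S :\ z).
Proof.
move=> zS xS hn hp; apply: vert_exists => [t|]; last first.
  rewrite cardsU1 !inE negb_and xS orbT.
  by have := cardsD1 z (val S); rewrite zS card_vert => /esym.
rewrite !inE => /orP[/eqP ->|/andP[tz tS]].
  rewrite (negPf (ordS_neq x)) /= negb_and negbK orbC; case: (boolP (nx x \in _)) => //= /hn ->.
  by rewrite eqxx.
rewrite (negPf (vert_stable tS)) andbF orbF; apply/eqP => e.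
by move: tz; rewrite -(hp _) -e ordSK ?eqxx.
Qed.

Definition moves y S T := (y \in val S) /\ val T = nx y |: (val S :\ y).

Lemma moves_memT y S T x : moves y S T ->
  (x \in val T) = (x == nx y) || (x != y) && (x \in val S).
Proof. by case=> _ ->; rewrite !inE. Qed.

Lemma moves_memS y S T x : moves y S T ->
  (x \in val S) = (x == y) || (x != nx y) && (x \in val T).
Proof.
case=> yS ->; rewrite !inE; case: (x =P y) => [->|_] //=.
by case: (x =P nx y) => //= ->; apply: negbTE; apply: vert_stable.
Qed.

Lemma moves_front y S T : moves y S T -> nx y \in val T.
Proof. by move=> h; rewrite (moves_memT _ h) eqxx. Qed.

Lemma moves_left y S T : moves y S T -> y \notin val T.
Proof. by move=> h; rewrite (moves_memT _ h) eqxx orbF eq_sym ordS_neq. Qed.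

Lemma moves_ahead y S T : moves y S T -> nx (nx y) \notin val S.
Proof.
move=> h; have := vert_stable (moves_front h); apply: contra => h2.
by rewrite (moves_memT _ h) h2 ordS2_neq orbT.
Qed.

Lemma moves_behind y S T : moves y S T -> pv y \notin val T.
Proof.
move=> h; rewrite (moves_memT _ h) negb_or (negPf (vert_stable_pred h.1)) andbF andbT.
by apply/eqP => e; have := ordS2_neq y; rewrite -e ord_predK eqxx.
Qed.

Lemma moves_uniqT y S T T' : moves y S T -> moves y S T' -> T = T'.
Proof. by move=> [_ e] [_ e']; apply: val_inj; rewrite e e'. Qed.

Lemma moves_uniqS y S S' T : moves y S T -> moves y S' T -> S = S'.
Proof.
by move=> h h'; apply/val_inj/setP => x; rewrite (moves_memS x h) (moves_memS x h').
Qed.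

Lemma moves_exists y S : y \in val S -> nx (nx y) \notin val S -> exists T, moves y S T.
Proof.
move=> yS h; have [||//||T eT] := @swap_exists S y (nx y); last by exists T.
- by [].
- exact: vert_stable.
- by rewrite (negPf h).
- by rewrite ordSK.
Qed.

Lemma moves_back_exists x T : x \in val T -> pv (pv x) \notin val T ->
  exists S, moves (pv x) S T.
Proof.
move=> xT h; have [||||S eS] := @swap_exists T x (pv x) => //.
- exact: vert_stable_pred.
- by rewrite ord_predK.
- by rewrite (negPf h).
exists S; split; first by rewrite eS !inE eqxx.
rewrite ord_predK eS; apply/setP => t; rewrite !inE.
case: (t =P x) => [->//|_] /=; case: (t =P pv x) => [->|_] //=.
by apply: negbTE; apply: vert_stable_pred.
Qed.

(** A step without direction, labelled by the edge {y, y + 1} of the m-cycle that it crosses. *)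
Definition flip_type y S T := moves y S T \/ moves y T S.

Lemma flip_typeC y S T : flip_type y S T -> flip_type y T S.
Proof. by case; [right|left]. Qed.

Lemma flip_type_uniq y S T T' : flip_type y S T -> flip_type y S T' -> T = T'.
Proof.
move=> [] h [] h'.
- exact: moves_uniqT h h'.
- by have := moves_left h'; rewrite h.1.
- by have := moves_left h; rewrite h'.1.
- exact: moves_uniqS h h'.
Qed.

(** Stated through adjacency alone, so that automorphisms preserve it; [flipP] identifies it with
    the steps. *)
Definition flip S T := S <> T /\
  forall W, (forall U, SGadj U S -> SGadj U T -> SGadj U W) -> W = S \/ W = T.

Lemma subset_vert S T : val S \subset val T -> S = T.
Proof.
by move=> h; apply/val_inj/eqP; rewrite eqEcard h !card_vert leqnn.
Qed.

Lemma adjP S T : reflect (forall x, x \in val S -> x \in val T -> False) (SGadj S T).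
Proof.
apply: (iffP idP) => [d x xS xT|h]; first by have := disjointFr d xS; rewrite xT.
by rewrite /SGadj disjoint_subset; apply/subsetP => x xS; apply/negP => /(h x xS).
Qed.

Lemma mem_rotate S x : (nx x \in val (rotate S)) = (x \in val S).
Proof. by rewrite val_move_vert ?mem_imset; [|exact: ordS_inj|exact: ordS_sym]. Qed.

Lemma vert_pick2 S : exists x y, [/\ x \in val S, y \in val S & x != y].
Proof.
have /card_gt1P[x [y [xS yS xy]]] : 1 < #|val S| by rewrite card_vert.
by exists x, y.
Qed.

(* The common neighbours of S and T cover everything outside S :|: T, so the
   only n-sets disjoint from all of them are S and T. *)
Lemma moves_flip y S T : moves y S T -> flip S T.
Proof.
move=> h; split=> [e|W hW]; first by have := moves_left h; rewrite -e h.1.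
(* B is a common neighbour of S and T; exchanging one of its elements for x gives one through any x
   outside both. *)
pose B := rotate T.
have BT x : x \in val B -> x \notin val T.
  by rewrite -(ord_predK x) mem_rotate => /vert_stable.
have BS x : x \in val B -> x \notin val S.
  move=> xB; rewrite (moves_memS x h) negb_or (negPf (BT _ xB)) andbF andbT.
  apply/eqP => e; have := moves_behind h.
  by rewrite -e -mem_rotate ord_predK xB.
have WST x : x \in val W -> (x \in val S) || (x \in val T).
  move=> xW; apply: contraT; rewrite negb_or => /andP[xS xT].
  suff [U [xU US UT]] : exists U, [/\ x \in val U, SGadj U S & SGadj U T].
    by have /adjP/(_ x xU xW) := hW U US UT.
  have [xB|xB] := boolP (x \in val B).
    by exists B; split=> //; apply/adjP => t tB; apply/negP; [apply: BS|apply: BT].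
  (* As x is outside T, nx x is outside B, so only pv x may be forced out. *)
  have [f [fB hf]] : exists f, f \in val B /\ (pv x \in val B -> pv x = f).
    have [pB|_] := boolP (pv x \in val B); first by exists (pv x).
    by have [f [_ [fB _ _]]] := vert_pick2 B; exists f.
  have [||||U eU] := @swap_exists B f x => //.
    by rewrite mem_rotate (negPf xT).
  exists U; split; first by rewrite eU !inE eqxx.
    apply/adjP => t; rewrite eU !inE => /orP[/eqP-> //|/andP[_ /BS/negP//]].
    exact/negP.
  apply/adjP => t; rewrite eU !inE => /orP[/eqP-> //|/andP[_ /BT/negP//]].
  exact/negP.
have [yW|yW] := boolP (y \in val W).
  left; apply: subset_vert; apply/subsetP => x xW; have := WST x xW.
  rewrite (moves_memT x h) => /orP[|/orP[/eqP e|/andP[]]] //.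
  by have := vert_stable yW; rewrite -e xW.
right; apply: subset_vert; apply/subsetP => x xW; have := WST x xW.
rewrite (moves_memS x h) => /orP[/orP[/eqP e|/andP[]]|] //.
by rewrite -e xW in yW.
Qed.

Lemma flipC S T : flip S T -> flip T S.
Proof.
move=> [ne h]; split=> [e|W hW]; first by apply: ne.
by case: (h W (fun U US UT => hW U UT US)); [right|left].
Qed.

(** Any vertex inside the union of S and T is S or T. If some x in T but not in S has a neighbour
    outside S, exchanging an element of S for x must yield T. Otherwise the symmetric difference is
    closed under predecessors, so it is the whole cycle, although it has at most 2n < m points. *)
Lemma flip_moves S T : flip S T -> exists y, flip_type y S T.
Proof.
move=> [ne hW].
have sub W : (forall x, x \in val W -> (x \in val S) || (x \in val T)) -> W = S \/ W = T.
  move=> h; apply: hW => U /adjP US /adjP UT; apply/adjP => x xU /h.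
  by case/orP; [apply: US|apply: UT].
have swapT z x W : x \in val T -> x \notin val S -> val W = x |: (val S :\ z) -> W = T.
  move=> xT xS eW; case: (sub W) => // [t|e].
    by rewrite eW !inE => /orP[/eqP ->|/andP[_ ->]] //; rewrite xT orbT.
  by move: xS; rewrite -e eW !inE eqxx.
have [/existsP[x /and3P[xT xS]]|] :=
  boolP [exists x, [&& x \in val T, x \notin val S & ~~ ((pv x \in val S) && (nx x \in val S))]].
  have [pS /= nS|pS] := boolP (pv x \in val S).
    have [||||W eW] := @swap_exists S (pv x) x => //.
      by rewrite (negPf nS).
    exists (pv x); left; split=> //.
    by rewrite ord_predK -(swapT _ _ _ xT xS eW).
  have [nS _|nS _] := boolP (nx x \in val S).
    have [||||W eW] := @swap_exists S (nx x) x => //.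
      by rewrite (negPf pS).
    exists x; right; split=> //.
    rewrite -(swapT _ _ _ xT xS eW) eW; apply/setP => t; rewrite !inE.
    case: (t =P nx x) => [->|_] /=; first by rewrite nS.
    by case: (t =P x) => [->|_] //=; rewrite (negPf xS).
  (* No neighbour of x lies in S, so two different elements could be exchanged for x, both yielding
     T. *)
  have [z1 [z2 [z1S z2S z12]]] := vert_pick2 S.
  have [||||W1 e1] := @swap_exists S z1 x => //; try by rewrite ?(negPf pS) ?(negPf nS).
  have [||||W2 e2] := @swap_exists S z2 x => //; try by rewrite ?(negPf pS) ?(negPf nS).
  have := swapT _ _ _ xT xS e1; rewrite -(swapT _ _ _ xT xS e2) => /(congr1 val)/setP/(_ z1).
  rewrite e1 e2 !inE eqxx z12 z1S /=.
  by case: (z1 =P x) => // e; rewrite -e z1S in xS.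
rewrite negb_exists => /forallP all2; exfalso.
have {}all2 x : x \in val T -> x \notin val S -> (pv x \in val S) && (nx x \in val S).
  by move=> xT xS; have := all2 x; rewrite xT xS /= negbK.
pose D := (val S :\: val T) :|: (val T :\: val S).
have cD (A B : V) : #|val A :\: val B| = n - #|val A :&: val B|.
  by rewrite cardsD card_vert.
have eqD : nx @: (val T :\: val S) = val S :\: val T.
  apply/eqP; rewrite eqEcard card_imset ?cD; last exact: ordS_inj.
  rewrite setIC leqnn andbT; apply/subsetP => _ /imsetP[x + ->].
  rewrite !inE => /andP[xS xT]; have /andP[_ ->] := all2 x xT xS.
  by rewrite (negPf (vert_stable xT)).
have closed t : t \in D -> pv t \in D.
  rewrite /D -eqD in_setU => /orP[/imsetP[x xD ->]|].
    by rewrite ordSK inE xD orbT.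
  rewrite eqD !inE => /andP[tS tT]; have /andP[-> _] := all2 t tT tS.
  by rewrite (vert_stable_pred tT).
have [/eqP|[x xD]] := set_0Vmem (val T :\: val S).
  by rewrite setD_eq0 => /subset_vert e; apply: ne.
have xD' : x \in D by rewrite inE xD orbT.
have full := pred_closed_full xD' closed.
have : m <= #|D|.
  apply: (@leq_trans #|[set: ground n k]|); first by rewrite cardsT card_ord.
  apply: subset_leq_card; apply/subsetP => t _; exact: full.
have := cardsU (val S :\: val T) (val T :\: val S); rewrite -/D !cD.
have kpos : 0 < k by case: (k) k_odd.
by lia.
Qed.

Lemma flipP S T : flip S T <-> exists y, flip_type y S T.
Proof.
split=> [/flip_moves //|[y [/moves_flip //|/moves_flip/flipC //]]].
Qed.

(** Conservation law: the count in A changes only if the step crosses the boundary of A. *)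
Lemma moves_card y S T (A : {set ground n k}) : moves y S T ->
  #|A :&: val S| + (nx y \in A) = #|A :&: val T| + (y \in A).
Proof.
move=> h; have e : #|(A :&: val S) :\ y| = #|(A :&: val T) :\ nx y|.
  apply: eq_card => x; rewrite !inE (moves_memT x h).
  case: (x =P y) => [->|_] /=; first by rewrite eq_sym (negPf (ordS_neq y)) !andbF.
  case: (x =P nx y) => [->|_] //=.
  by rewrite (negPf (vert_stable h.1)) andbF.
have := cardsD1 y (A :&: val S); have := cardsD1 (nx y) (A :&: val T).
by rewrite !inE h.1 (moves_front h) !andbT e => -> ->; rewrite addnAC [in LHS](addnC (y \in A)) addnAC.
Qed.

(* Only flips of types y and w change the number of elements in the cyclic
   interval ]w, y]. *)
Lemma quad_type y z u v S S1 S2 S3 :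
    flip_type y S S1 -> flip_type z S1 S2 -> flip_type u S2 S3 -> flip_type v S3 S ->
    S <> S2 -> S1 <> S3 ->
  flip_type y S2 S3.
Proof.
move=> fy fz fu fv ne02 ne13.
have [<-//|yu] := eqVneq u y.
have yz : y != z.
  by apply/eqP => e; rewrite -e in fz; apply: ne02; apply: flip_type_uniq (flip_typeC fy) fz.
have yv : y != v.
  by apply/eqP => e; rewrite -e in fv; apply: ne13; apply: flip_type_uniq fy (flip_typeC fv).
(* The cycle has m >= 5 points, so some w differs from the four labels. *)
have [w wN] : exists w, w \notin [set y; z; u; v].
  apply/existsP; rewrite -negb_forall; apply/negP => /forallP all4.
  suff : m <= 4 by case: (k) k_odd => // ? _; lia.
  apply: (@leq_trans #|[set: ground n k]|); first by rewrite cardsT card_ord.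
  apply: (@leq_trans #|[set y; z; u; v]|).
    by apply: subset_leq_card; apply/subsetP => t _; exact: all4.
  by do 3?[rewrite setUC cardsU1; case: (_ \notin _) => /=]; rewrite ?cards1.
move: wN; rewrite !inE !negb_or -!andbA => /and4P[wy wz wu wv].
pose A := [set x : ground n k | if w < y then w < x <= y else (x <= y) || (w < x)].
have ne_val (a b : ground n k) : a != b -> a <> b :> nat by move=> + /ord_inj e; rewrite e eqxx.
have Aother t : w != t -> y != t -> (nx t \in A) = (t \in A).
  move=> /ne_val wt /ne_val yt; rewrite !inE; have := ordS_spec t.
  by have := ne_val _ _ wy; have := ltn_ord w; have := ltn_ord y; clear -wt yt; case: ifP; lia.
have Ay : y \in A by rewrite !inE; have := ne_val _ _ wy; clear; case: ifP; lia.
have AnS : nx y \notin A.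
  rewrite !inE; have := ordS_spec y; have := ne_val _ _ wy.
  by have := ltn_ord w; clear; case: ifP; lia.
have same t (P Q : V) : w != t -> y != t -> flip_type t P Q ->
    #|A :&: val P| = #|A :&: val Q|.
  by move=> wt yt [] /(moves_card A); rewrite Aother // => /addIn.
have e12 := same _ _ _ wz yz fz.
have e23 : #|A :&: val S2| = #|A :&: val S3| by apply: same fu => //; rewrite eq_sym.
have e30 := same _ _ _ wv yv fv.
by case: fy => /(moves_card A); rewrite Ay (negPf AnS) addn0 addn1 e12 e23 e30 => e; case: (n_Sn _ e).
Qed.

(** An index-free form of being the chain from a; see [sole_start_chain]. *)
Definition sole_start S a :=
  a \in val S /\ forall x, x \in val S -> x != a -> pv (pv x) \in val S.

(* Pushes the particles other than y one step at a time back towards y. *)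
Lemma descent y (Q : V -> V -> Prop) :
    (forall S S', moves y S S' -> sole_start S' (nx y) -> Q S S') ->
    (forall z S S' T T', moves y S S' -> moves y T T' -> moves z T S -> moves z T' S' ->
       Q T T' -> Q S S') ->
  forall S S', moves y S S' -> Q S S'.
Proof.
move=> base step.
pose off (x : ground n k) := if y <= x then x - y else x + m - y.
pose mu S := \sum_(x in val S) off x.
(* [off] is the forward distance from y; the sum [mu] drops with every push. *)
have off_lt x : off x < m by rewrite /off; have := ltn_ord x; have := ltn_ord y; case: ifP; lia.
have off_pv x : 0 < off x -> off (pv x) = (off x).-1.
  rewrite /off; have := ord_pred_spec x; have := ltn_ord x; have := ltn_ord y.
  by do 2?[case: ifP]; lia.
have off_eq x d : d < 4 -> off x = d -> x = iter d nx y.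
  elim: d x => [|d IHd] x d4 offx.
    by apply: ord_inj; move: offx; rewrite /= /off; have := ltn_ord y; case: ifP; lia.
  rewrite iterS -(IHd (pv x)) ?ord_predK ?off_pv ?offx //; exact: ltnW.
(* Elements of S other than y are at distance at least 3, and one at distance 3 has y + 1, an
   element of S', two steps behind it. *)
have compressed S S' : moves y S S' ->
    (forall x, x \in val S -> x != y -> 3 < off x -> pv (pv x) \in val S) ->
    sole_start S' (nx y).
  move=> h hS; split=> [|x xS' xny]; first exact: moves_front h.
  have [xy xS] : x != y /\ x \in val S.
    by move: xS'; rewrite (moves_memT x h) (negPf xny) => /andP.
  have [off4|] := ltnP 3 (off x).
    rewrite (moves_memT _ h) hS // andbT orbC; case: eqP => //= e.
    have := off_pv x; have := off_pv (pv x); rewrite e /off leqnn subnn.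
    by rewrite -/(off x) -/(off (pv x)); lia.
  rewrite leq_eqVlt => /orP[/eqP/off_eq -> //|].
    by rewrite /= !ordSK (moves_front h).
  rewrite ltnS leq_eqVlt => /orP[/eqP/off_eq e|].
    by have := moves_ahead h; rewrite -[nx (nx y)]/(iter 2 nx y) -e // xS.
  rewrite ltnS leq_eqVlt => /orP[/eqP/off_eq e|].
    by move: xny; rewrite e // eqxx.
  by rewrite ltnS leqn0 => /eqP/off_eq e; move: xy; rewrite e // eqxx.
(* A gap behind x lets x retreat in S and in S' alike; distance above 3 keeps this clear of y and y
   + 1, so the square closes. *)
have back S S' x : moves y S S' -> x \in val S -> x != y -> 3 < off x ->
    pv (pv x) \notin val S -> exists T T', [/\ moves y T T', moves (pv x) T S,
      moves (pv x) T' S' & mu T < mu S].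
  move=> h xS xy off4 pS; have [T hT] := moves_back_exists xS pS.
  have pxy : pv x != y.
    by apply/eqP => e; have := off_pv x; rewrite e /off leqnn subnn -/(off x); lia.
  have xny : x != nx y by apply/eqP => e; rewrite e ordSK eqxx in pxy.
  have [||T' hT'] := @moves_back_exists x S'.
  - by rewrite (moves_memT x h) xy xS orbT.
  - rewrite (moves_memT _ h) (negPf pS) andbF orbF; apply/eqP => e.
    have := off_pv x; have := off_pv (pv x); have := off_pv (pv (pv x)).
    by rewrite e ordSK /off leqnn subnn -/(off x) -/(off (pv x)) -/(off (nx y)); lia.
  exists T, T'; split=> //.
    split; first by rewrite (moves_memS y hT) ord_predK [y == x]eq_sym xy h.1 orbT.
    apply/setP => t; rewrite !inE (moves_memS t hT') (moves_memS t hT) ord_predK (moves_memT t h).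
    case: (t =P pv x) => [->|_] /=; first by rewrite pxy orbT.
    case: (t =P x) => [->|_] /=; first by rewrite (negPf xny) andbF.
    by [].
  rewrite /mu (bigD1 (pv x)) ?[X in _ < X](bigD1 x) //=; last exact: hT.1.
  rewrite off_pv; last exact: leq_trans off4.
  rewrite (eq_bigl (fun t => (t \in val S) && (t != x))).
    by rewrite ltn_add2r prednK // (leq_trans _ off4).
  move=> t; rewrite (moves_memS t hT) ord_predK; case: (t =P pv x) => [->|_] /=.
    by rewrite (negPf (vert_stable_pred xS)).
  by rewrite andbT andbC.
move=> S; move: {2}(mu S).+1 (ltnSn (mu S)) => N.
elim: N S => // N IH S leN S' h.
have [/existsP[x /and4P[xS xy off4 pS]]|none] := boolP [exists x,
    [&& x \in val S, x != y, 3 < off x & pv (pv x) \notin val S]].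
  have [T [T' [hTT' hT hT' lt_mu]]] := back S S' x h xS xy off4 pS.
  by apply: step h hTT' hT hT' (IH T _ T' hTT'); apply: leq_trans lt_mu _.
apply: base h (compressed _ _ h _) => x xS xy off4; apply: contraR none => pS.
by apply/existsP; exists x; rewrite xS xy off4.
Qed.

(** * Chains as intervals in the cyclic order of steps by two *)

Lemma m_gt0 : 0 < m.
Proof. by rewrite addn_gt0 muln_gt0 (ltnW n_gt1). Qed.

Lemma m_odd : odd m. Proof. by rewrite oddD oddM. Qed.

Definition pt (i : nat) : ground n k := Ordinal (ltn_pmod (2 * i) m_gt0).

Lemma pt_val i : i < m -> pt i = (if 2 * i < m then 2 * i else 2 * i - m) :> nat.
Proof.
move=> im; rewrite /=; case: ifP => h; first by rewrite modn_small.
by rewrite -[in LHS](@subnK m (2 * i)) ?modnDr ?modn_small; lia.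
Qed.

(* The position of x in the cyclic order 0, 2, 4, .., m-1, 1, 3, .. *)
Definition idx x : nat := if odd x then (x + m)./2 else x./2.

Lemma idx_lt x : idx x < m.
Proof. by rewrite /idx; have := ltn_ord x; have := m_odd; case: ifP; lia. Qed.

Lemma idx_pt i : i < m -> idx (pt i) = i.
Proof. by move=> im; rewrite /idx pt_val //; have := m_odd; do 2?[case: ifP]; lia. Qed.

Lemma idx_inj : injective idx.
Proof.
move=> x y; rewrite /idx => e; apply: ord_inj; move: e; have := m_odd.
by have := ltn_ord x; have := ltn_ord y; do 2?[case: ifP]; lia.
Qed.

Lemma pt_idx x : pt (idx x) = x.
Proof. by apply: idx_inj; rewrite idx_pt ?idx_lt. Qed.

(** (m + 1)/2 is the inverse of 2 modulo the odd m. *)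
Lemma idx_ordS x :
  idx (nx x) = if idx x + (m.+1)./2 < m then idx x + (m.+1)./2 else idx x + (m.+1)./2 - m.
Proof.
rewrite /idx; have := ordS_spec x; have := m_odd; have := ltn_ord x.
by do 3?[case: ifP]; lia.
Qed.

Lemma idx_pred x :
  idx (pv x) = if (m.+1)./2 <= idx x then idx x - (m.+1)./2 else idx x + m - (m.+1)./2.
Proof.
have := idx_ordS (pv x); rewrite ord_predK; have := idx_lt (pv x); have := idx_lt x.
by have := m_odd; do 2?[case: ifP]; lia.
Qed.

Lemma idx_pred2 x : idx (pv (pv x)) = if 0 < idx x then (idx x).-1 else m.-1.
Proof. by rewrite !idx_pred; have := idx_lt x; have := m_odd; do 3?[case: ifP]; lia. Qed.

Lemma idx_ordS2 x : idx (nx (nx x)) = if (idx x).+1 < m then (idx x).+1 else 0.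
Proof. by rewrite !idx_ordS; have := idx_lt x; have := m_odd; do 3?[case: ifP]; lia. Qed.

(** A cyclic interval of n indices from u; the second disjunct is the part wrapping past m. *)
Definition arc (u i : nat) := (u <= i < u + n) || (i + m < u + n).

Definition chain S u := u < m /\ forall x, (x \in val S) = arc u (idx x).

Lemma chain_uniq S T u : chain S u -> chain T u -> S = T.
Proof. by move=> [_ hS] [_ hT]; apply/val_inj/setP => x; rewrite hS hT. Qed.

Lemma card_arc u : u < m -> #|[set x : ground n k | arc u (idx x)]| = n.
Proof.
move=> um; pose f (j : 'I_n) := pt (if u + j < m then u + j else u + j - m).
have lt_m (j : 'I_n) : (if u + j < m then u + j else u + j - m) < m.
  by have := ltn_ord j; clear -um; case: ifP; lia.
rewrite (_ : [set x | _] = f @: 'I_n).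
  rewrite card_imset ?card_ord // => i j /(congr1 idx); rewrite !idx_pt // => e.
  apply: ord_inj; move: e; have := ltn_ord i; have := ltn_ord j; clear -um.
  by do 2?[case: ifP]; lia.
apply/setP => x; rewrite inE; apply/idP/imsetP => [ax|[j _ ->]]; last first.
  by rewrite /arc idx_pt //; have := ltn_ord j; clear -um; case: ifP; lia.
have lt_n : (if u <= idx x then idx x - u else idx x + m - u) < n.
  by move: ax; rewrite /arc; have := idx_lt x; clear -um; case: ifP; lia.
exists (Ordinal lt_n) => //; apply: idx_inj; rewrite /f idx_pt ?lt_m //=.
by move: ax; rewrite /arc; have := idx_lt x; clear -um; do 2?[case: ifP]; lia.
Qed.

(** Neighbouring points have indices at least n apart either way round, so an arc of length n never
    holds both. *)
Lemma chain_exists u : u < m -> exists S, chain S u.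
Proof.
move=> um; have [|S eS] := @vert_exists n k [set x | arc u (idx x)] _ (card_arc um).
  move=> x; rewrite !inE idx_ordS /arc; have := idx_lt x; have := m_odd.
  by clear -um; case: ifP; lia.
by exists S; split=> // x; rewrite eS inE.
Qed.

(** S is downward closed for the offset from a, hence the initial segment of size n. *)
Lemma sole_start_chain S a : sole_start S a -> chain S (idx a).
Proof.
move=> [aS hS]; split=> [|x]; first exact: idx_lt.
pose off y := if idx a <= idx y then idx y - idx a else idx y + m - idx a.
have arcE y : arc (idx a) (idx y) = (off y < n).
  by rewrite /arc /off; have := idx_lt y; have := idx_lt a; clear; case: ifP; lia.
have off_eq y z : off y = off z -> y = z.
  move=> e; apply: idx_inj; move: e; rewrite /off; have := idx_lt y; have := idx_lt z.
  by have := idx_lt a; clear; do 2?[case: ifP]; lia.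
have off_pred2 y : 0 < off y -> off (pv (pv y)) = (off y).-1.
  rewrite /off idx_pred2; have := idx_lt y; have := idx_lt a; clear.
  by do 3?[case: ifP]; lia.
have down d : forall y z, y \in val S -> off y = off z + d -> z \in val S.
  elim: d => [|d IH] y z yS; first by rewrite addn0 => /off_eq <-.
  rewrite addnS => e; apply: (IH (pv (pv y))); last by rewrite off_pred2 e.
  by apply: hS => //; apply/eqP => ya; move: e; rewrite ya /off leqnn subnn.
suff -> : val S = [set y | arc (idx a) (idx y)] by rewrite inE.
have cS := card_vert S; have cA := card_arc (idx_lt a).
have [/subsetP sub|/subsetPn[y yS]] := boolP (val S \subset [set y | arc (idx a) (idx y)]).
  by apply/eqP; rewrite eqEcard cS cA leqnn andbT; apply/subsetP.
rewrite inE arcE -leqNgt => ny; apply/esym/eqP; rewrite eqEcard cS cA leqnn andbT.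
apply/subsetP => z; rewrite inE arcE => zn; apply: (down (off y - off z) y) => //.
by rewrite subnKC // ltnW // (leq_trans zn).
Qed.

Lemma chain_sole_start S u : chain S u -> sole_start S (pt u).
Proof.
move=> [um hS]; split=> [|x].
  by rewrite hS idx_pt // /arc leqnn -[X in X < _]addn0 ltn_add2l (ltnW n_gt1).
rewrite !hS idx_pred2 /arc => xS xu; have : idx x <> u.
  by move=> e; move: xu; rewrite -e pt_idx eqxx.
by move: xS; have := idx_lt x; clear -um n_gt1; case: ifP; lia.
Qed.

(** Two cyclic intervals of length n meet iff one contains the start of the other. *)
Lemma chain_adj S T u v : chain S u -> chain T v ->
  SGadj S T = ~~ (arc u v || arc v u).
Proof.
move=> [um hS] [vm hT]; apply/adjP/idP => [h|h x]; last first.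
  by rewrite hS hT; move: h; rewrite /arc; have := idx_lt x; clear -um vm; lia.
have [uS _] := chain_sole_start (conj um hS); have [vT _] := chain_sole_start (conj vm hT).
apply/negP => /orP[]a.
  by apply: (h (pt v) _ vT); rewrite hS idx_pt.
by apply: (h (pt u) uS _); rewrite hT idx_pt.
Qed.

Lemma chain_start_behind S u : chain S u -> pv (pv (pt u)) \notin val S.
Proof.
move=> [um hS]; rewrite hS idx_pred2 idx_pt // /arc.
by clear -um n_gt1; case: ifP; lia.
Qed.

Lemma chain_idx_uniq S u v : chain S u -> chain S v -> u = v.
Proof.
move=> hu hv; have [uS _] := chain_sole_start hu; have [_ sole] := chain_sole_start hv.
rewrite -(idx_pt hu.1) -(idx_pt hv.1); congr idx; apply/eqP; apply: contraT => uv.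
by have := sole _ uS uv; rewrite (negPf (chain_start_behind hu)).
Qed.

Definition rigid S := exists A B, forall T, flip S T -> T = A \/ T = B.

Definition last_idx u := if u + n.-1 < m then u + n.-1 else u + n.-1 - m.

Lemma last_idx_lt u : u < m -> last_idx u < m.
Proof. by rewrite /last_idx; case: ifP; lia. Qed.

Lemma chain_end S u y : chain S u -> y \in val S -> nx (nx y) \notin val S ->
  idx y = last_idx u.
Proof.
move=> [um memS]; rewrite !memS idx_ordS2 /arc /last_idx; have := idx_lt y.
by clear -um n_gt1; do 2?[case: ifP]; lia.
Qed.

(** Only the start can step back and only the last element can step forward. *)
Lemma chain_rigid S u : chain S u -> rigid S.
Proof.
move=> hS; have [um memS] := hS; have [aS sole] := chain_sole_start hS.
have aN := chain_start_behind hS.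
have [A hA] := moves_back_exists aS aN.
have vm := last_idx_lt um.
have [||B hB] := @moves_exists (pt (last_idx u)) S.
- by rewrite memS idx_pt // /arc /last_idx; clear -um n_gt1; case: ifP; lia.
- rewrite memS idx_ordS2 idx_pt // /arc /last_idx; clear -um n_gt1 k_odd.
  by do 2?[case: ifP]; lia.
exists A, B => T /flipP [y [h|h]].
  right; have yv := chain_end hS h.1 (moves_ahead h).
  by move: h; rewrite -(pt_idx y) yv => h; exact: moves_uniqT h hB.
left; suff ya : nx y = pt u by rewrite -ya ordSK in hA; exact: moves_uniqS h hA.
apply/eqP; apply: contraT => ya; have := sole _ (moves_front h) ya.
by rewrite ordSK (negPf (moves_behind h)).
Qed.

(** Otherwise S is closed under x -> x - 2, and S with its predecessors is the whole cycle, although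
    it has at most 2n < m points. *)
Lemma start_exists S : exists2 a, a \in val S & pv (pv a) \notin val S.
Proof.
have [/existsP[a /andP[]]|] := boolP [exists a, (a \in val S) && (pv (pv a) \notin val S)].
  by exists a.
rewrite negb_exists => /forallP h.
have closed x : x \in val S -> pv (pv x) \in val S.
  by move=> xS; have := h x; rewrite xS negbK.
pose D := val S :|: [set x | nx x \in val S].
have [a [_ [aS _ _]]] := vert_pick2 S.
have full := @pred_closed_full D a.
have cD : #|D| <= n + n.
  apply: leq_trans (leq_card_setU _ _) _; rewrite card_vert leq_add2l -(card_imset _ (@ordS_inj m)).
  apply: leq_trans (_ : #|val S| <= n); last by rewrite card_vert.
  by apply: subset_leq_card; apply/subsetP => _ /imsetP[x + ->]; rewrite inE.
have mD : m <= #|D|.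
  apply: (@leq_trans #|[set: ground n k]|); first by rewrite cardsT card_ord.
  apply: subset_leq_card; apply/subsetP => t _; apply: full; first by rewrite inE aS.
  move=> y; rewrite !inE => /orP[yS|/closed]; first by rewrite ord_predK yS orbT.
  by rewrite ordSK => ->.
have : m <= n + n := leq_trans mD cD.
by clear -k_odd; lia.
Qed.

(** Otherwise x -> x + 2 permutes the finite set S, leaving no start. *)
Lemma end_exists S : exists2 a, a \in val S & nx (nx a) \notin val S.
Proof.
have [/existsP[a /andP[]]|] := boolP [exists a, (a \in val S) && (nx (nx a) \notin val S)].
  by exists a.
rewrite negb_exists => /forallP h.
have /subsetP sub : (fun x => nx (nx x)) @: val S \subset val S.
  by apply/subsetP => _ /imsetP[x xS ->]; have := h x; rewrite xS negbK.
have [a aS] := start_exists S; case/negP.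
have : a \in (fun x => nx (nx x)) @: val S.
  suff /eqP -> : (fun x => nx (nx x)) @: val S == val S by [].
  rewrite eqEcard card_imset; first by rewrite leqnn andbT; apply/subsetP.
  by move=> x y /ordS_inj/ordS_inj.
by case/imsetP=> x xS ->; rewrite !ordSK.
Qed.

(** A second start b would give three distinct flips: a back, b back, and an end e forward. *)
Lemma rigid_chain S : rigid S -> exists u, chain S u.
Proof.
move=> [A [B hAB]]; have [a aS aN] := start_exists S; have [e eS eN] := end_exists S.
exists (idx a); apply: sole_start_chain; split=> // b bS ba; apply: contraT => bN; exfalso.
have [Ta ha] := moves_back_exists aS aN.
have [Tb hb] := moves_back_exists bS bN.
have [Te he] := moves_exists eS eN.
have fT T y : flip_type y S T -> T = A \/ T = B.
  by move=> h; apply: hAB; apply/flipP; exists y.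
have nab : Ta <> Tb.
  move=> eT; have := vert_stable ha.1; rewrite ord_predK eT.
  by have := moves_memT a hb; rewrite aS ord_predK eq_sym (negPf ba) /= => /esym/andP[_ ->].
have nae x T : x \in val S -> moves (pv x) T S -> T <> Te.
  move=> xS h eT; have := moves_front he; rewrite -eT (moves_memS _ h) ord_predK.
  rewrite (negPf (vert_stable eS)) andbF orbF => /eqP ex.
  by move: eN; rewrite ex ord_predK xS.
have := fT _ _ (or_intror ha); have := fT _ _ (or_intror hb); have := fT _ _ (or_introl he).
by have := nae _ _ aS ha; have := nae _ _ bS hb; intuition congruence.
Qed.


(** * The cyclic order of the chains, recovered from disjointness *)

Definition meet_arc (w u : nat) := arc w u || arc u w.

Definition succ_idx u := if u.+1 < m then u.+1 else 0.

(** The starts meeting u form the interval from u-n+1 to u+n-1; passing to u+1 loses only its left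
    end. *)
Lemma meet_arc_succ u : u < m -> exists w : nat, [/\ w < m, meet_arc w u, ~~ meet_arc w (succ_idx u)
  & forall w' : nat, w' < m -> meet_arc w' u -> ~~ meet_arc w' (succ_idx u) -> w' = w].
Proof.
move=> um; exists (if n.-1 <= u then u - n.-1 else u + m - n.-1).
rewrite /meet_arc /succ_idx /arc; clear -n_gt1 k_odd um.
by split; [| | |move=> w' wm]; do 2?[case: ifP]; lia.
Qed.

(** Let e be the distance from u to v. The interval of starts meeting v spares the two left ends of
    that of u, or its two right ends, or covers both sides; then its complement, of k + 1 >= 2
    starts, lies inside that of u. *)
Lemma meet_arc_two u v : u < m -> v < m -> u <> v -> v <> succ_idx u -> u <> succ_idx v ->
  exists w w' : nat, [/\ w < m, w' < m, w <> w', meet_arc w u && ~~ meet_arc w v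
    & meet_arc w' u && ~~ meet_arc w' v].
Proof.
pose nrm i := if i < m then i else i - m.
move=> um vm uv vsu usv; pose e := if u <= v then v - u else v + m - u.
have e2 : 2 <= e <= m - 2.
  by move: uv vsu usv; rewrite /e /succ_idx; clear -um vm; do 3?[case: ifP]; lia.
have ve : v = nrm (u + e).
  by rewrite /nrm /e; clear -um vm; do 2?[case: ifP]; lia.
clearbody e; rewrite {}ve; clear uv vsu usv vm v.
have [le_e|lt_e] := leqP e (m - 2 * n.-1 - 1).
  exists (nrm (u + m - n.-1)), (nrm (u + m - n.-1 + 1)).
  rewrite /meet_arc /arc /nrm; clear -n_gt1 k_odd um e2 le_e.
  by split; do 3?[case: ifP]; lia.
have [le_e'|lt_e'] := leqP (2 * n.-1 + 1) e.
  exists (nrm (u + n.-1)), (nrm (u + n.-1 - 1)).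
  rewrite /meet_arc /arc /nrm; clear -n_gt1 k_odd um e2 lt_e le_e'.
  by split; do 3?[case: ifP]; lia.
exists (nrm (nrm (u + e) + n)), (nrm (nrm (u + e) + n + 1)).
rewrite /meet_arc /arc /nrm; clear -n_gt1 k_odd um e2 lt_e lt_e'.
by split; do 3?[case: ifP]; lia.
Qed.

(* Among the chains, exactly one meets S and misses T iff T is S moved by two
   positions. *)
Definition near S T := exists W, [/\ rigid W, ~~ SGadj W S, SGadj W T
  & forall W', rigid W' -> ~~ SGadj W' S -> SGadj W' T -> W' = W].

Lemma near_chain_succ S T u : chain S u -> chain T (succ_idx u) -> near S T.
Proof.
move=> hS hT; have [w [wm wu wsu w_uniq]] := meet_arc_succ hS.1.
have [W hW] := chain_exists wm; exists W; split.
- exact: chain_rigid hW.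
- by rewrite (chain_adj hW hS) negbK.
- by rewrite (chain_adj hW hT).
move=> W' /rigid_chain[w' hW']; rewrite (chain_adj hW' hS) (chain_adj hW' hT) negbK => a b.
by have e := w_uniq w' hW'.1 a b; rewrite e in hW'; exact: chain_uniq hW' hW.
Qed.

Lemma near_chain S T u v : chain S u -> chain T v -> near S T ->
  v = succ_idx u \/ u = succ_idx v.
Proof.
move=> hS hT [W [_ WS WT W_uniq]].
have [->|vsu] := eqVneq v (succ_idx u); first by left.
have [->|usv] := eqVneq u (succ_idx v); first by right.
have uv : u <> v.
  by move=> e; rewrite e in hS; move: WS; rewrite (chain_uniq hS hT) WT.
have [w [w' [wm wm' ww' /andP[a b] /andP[a' b']]]] :=
  meet_arc_two hS.1 hT.1 uv (elimN eqP vsu) (elimN eqP usv).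
have [W1 h1] := chain_exists wm; have [W2 h2] := chain_exists wm'.
have e1 : W1 = W.
  by apply: W_uniq; [exact: chain_rigid h1|rewrite (chain_adj h1 hS) negbK|rewrite (chain_adj h1 hT)].
have e2 : W2 = W.
  by apply: W_uniq; [exact: chain_rigid h2|rewrite (chain_adj h2 hS) negbK|rewrite (chain_adj h2 hT)].
case: ww'; move: h1 h2; rewrite e1 e2 => h1 h2; exact: chain_idx_uniq h1 h2.
Qed.

(** * Automorphisms fixing two consecutive chains *)

Section Automorphism.
Variable gamma : V -> V.
Hypothesis gamma_aut : is_automorphism gamma.

Lemma aut_inv : exists d, [/\ cancel gamma d, cancel d gamma & is_automorphism d].
Proof.
have [[d gK dK] ga] := gamma_aut; exists d; split=> //; split; first by exists gamma.
by move=> S T; rewrite -ga !dK.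
Qed.

Lemma aut_inj : injective gamma.
Proof. by have [/bij_inj] := gamma_aut. Qed.

Lemma aut_adj S T : SGadj (gamma S) (gamma T) = SGadj S T.
Proof. by case: gamma_aut. Qed.

Lemma flip_aut S T : flip S T -> flip (gamma S) (gamma T).
Proof.
have [d [gK dK [_ da]]] := aut_inv; move=> [ne h]; split=> [/aut_inj //|W hW].
have [U US UT|<-|<-] := h (d W); [|by left; rewrite dK|by right; rewrite dK].
by rewrite -aut_adj dK; apply: hW; rewrite aut_adj.
Qed.

End Automorphism.

Lemma rigid_aut gamma S : is_automorphism gamma -> rigid S -> rigid (gamma S).
Proof.
move=> ga [A [B h]]; have [d [gK dK da]] := aut_inv ga; exists (gamma A), (gamma B) => T.
move/(flip_aut da); rewrite gK => /h; case=> <-; rewrite dK; [left|right]; done.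
Qed.

Lemma near_aut gamma S T : is_automorphism gamma -> near S T -> near (gamma S) (gamma T).
Proof.
move=> ga [W [rW WS WT W_uniq]]; have [d [gK dK da]] := aut_inv ga.
exists (gamma W); rewrite !(aut_adj ga); split=> // [|W' rW' WS' WT'].
  exact: rigid_aut.
rewrite -(W_uniq (d W')) ?dK //; first exact: rigid_aut.
  by rewrite -(aut_adj ga) dK.
by rewrite -(aut_adj ga) dK.
Qed.

Section FixedChains.
Variables (gamma : V -> V) (S0 S1 : V).
Hypotheses (gamma_aut : is_automorphism gamma)
  (chain0 : chain S0 0) (fix0 : gamma S0 = S0)
  (chain1 : chain S1 1) (fix1 : gamma S1 = S1).

(** The image of chain u + 2 is near the fixed chain u + 1, so it is chain u or u + 2; the former is
    already taken. *)
Lemma fixed_chain S u : chain S u -> gamma S = S.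
Proof.
suff : forall u, (forall S, chain S u -> gamma S = S) /\
    (u.+1 < m -> forall S, chain S u.+1 -> gamma S = S).
  by move=> h hS; have [fixu _] := h u; apply: fixu.
clear S u; elim=> [|u [IH0 IH1]].
  by split=> [S hS|_ S hS]; [rewrite (chain_uniq hS chain0)|rewrite (chain_uniq hS chain1)].
split=> [S hS|um U hU]; first by apply: (IH1 hS.1).
have um1 : u.+1 < m by exact: ltnW.
have [T hT] := chain_exists um1; have [S hS] := chain_exists (ltnW um1).
have hU' : chain U (succ_idx u.+1) by rewrite /succ_idx um.
have nearTU := near_aut gamma_aut (near_chain_succ hT hU').
rewrite (IH1 um1 T hT) in nearTU.
have [v hv] := rigid_chain (rigid_aut gamma_aut (chain_rigid hU)).
have [ev|] := near_chain hT hv nearTU.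
  by rewrite ev in hv; exact: chain_uniq hv hU'.
rewrite /succ_idx; case: ifP => // _ [ev]; rewrite -ev in hv.
have := IH0 S hS; rewrite -[in RHS](chain_uniq hv hS) => /(aut_inj gamma_aut) e.
rewrite e in hS; have := chain_idx_uniq hS hU => /eqP.
by rewrite -addn2 -{1}[u]addn0 eqn_add2l.
Qed.

(* The chain starting at the last element of S' meets S and misses the other
   neighbour of S'. *)
Lemma fixed_flip y S S' : moves y S S' -> sole_start S' (nx y) -> gamma S = S.
Proof.
move=> h sole; have hS' := sole_start_chain sole; set u := idx (nx y) in hS'.
have [um memS'] := hS'.
have fl := flip_aut gamma_aut (moves_flip h); rewrite (fixed_chain hS') in fl.
have [z [hz|hz]] := flip_moves fl.
  have e : z = y.
    apply: (@ordS_inj m); apply/eqP; apply: contraT => ne.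
    have := sole.2 _ (moves_front hz) ne.
    by rewrite ordSK (negPf (moves_behind hz)).
  by rewrite e in hz; exact: moves_uniqS hz h.
(* Remaining case: gamma S would be S' with its last element z pushed forward. *)
have zu := chain_end hS' hz.1 (moves_ahead hz).
have [W hW] := chain_exists (last_idx_lt um).
have ptW : pt (last_idx u) \in val W by case: (chain_sole_start hW).
have : ~~ SGadj W S.
  apply/adjP => /(_ _ ptW); apply; rewrite (moves_memS _ h) -zu pt_idx hz.1 andbT.
  have -> : z != nx y.
    apply/eqP => e; move: zu; rewrite e -/u /last_idx; clear -n_gt1 um.
    by case: ifP; lia.
  by rewrite orbT.
rewrite -(aut_adj gamma_aut) (fixed_chain hW) => /negP[]; apply/adjP => x.
rewrite hW.2 (moves_memT x hz) memS' => xW /orP[/eqP e|/andP[xz]].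
  move: xW; rewrite e idx_ordS zu /arc; have := last_idx_lt um.
  by clear -n_gt1 k_odd; case: ifP; lia.
have : idx x <> last_idx u by rewrite -zu => /idx_inj e; rewrite e eqxx in xz.
by move: xW; rewrite /arc /last_idx; have := idx_lt x; clear -um n_gt1 k_odd; do 2?[case: ifP]; lia.
Qed.

(** Each descent step is a square of flips, and so is its image; [quad_type] carries the type y to
    the opposite side. *)
Lemma fixed_type y S S' : moves y S S' -> flip_type y (gamma S) (gamma S').
Proof.
move: S S'; apply: descent => [S S' h sole|z S S' T T' h hT hz hz' IH].
  by rewrite (fixed_flip h sole) (fixed_chain (sole_start_chain sole)); left.
have flt a A B : moves a A B -> exists b, flip_type b (gamma A) (gamma B).
  by move=> /moves_flip/(flip_aut gamma_aut)/flip_moves.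
have [b hb] := flt _ _ _ hz'; have [c hc] := flt _ _ _ h; have [d hd] := flt _ _ _ hz.
apply/flip_typeC; apply: (quad_type IH hb (flip_typeC hc) (flip_typeC hd)).
  by move/(aut_inj gamma_aut) => e; have := moves_left h; rewrite -e hT.1.
by move/(aut_inj gamma_aut) => e; have := moves_left hT; rewrite e h.1.
Qed.

(** In a descent step, S and gamma S are both flips of type z of the fixed vertex T, hence equal. *)
Lemma fixed_all S : gamma S = S.
Proof.
have [y yS yN] := end_exists S; have [S' h] := moves_exists yS yN.
move: S S' h {yS yN}; apply: descent => [S S' h sole|z S S' T T' h hT hz hz' IH].
  exact: fixed_flip h sole.
have := fixed_type hz; rewrite IH => hf.
by apply: flip_type_uniq hf (or_introl hz).
Qed.

End FixedChains.

Lemma rotate2_chain S u : chain S u -> chain (rotate (rotate S)) (succ_idx u).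
Proof.
move=> [um hS]; split=> [|x]; first by rewrite /succ_idx; case: ifP => // _; exact: m_gt0.
rewrite -[x in LHS]ord_predK mem_rotate -[pv x]ord_predK mem_rotate hS idx_pred2.
rewrite /succ_idx /arc; have := idx_lt x; clear -um n_gt1 k_odd.
by do 2?[case: ifP]; lia.
Qed.

(** As k + 1 is even, its index is (k + 1)/2, from which indices are subtracted modulo m. *)
Lemma mirror_idx x : idx (mirror x) =
  if idx x <= (k.+1)./2 then (k.+1)./2 - idx x else (k.+1)./2 + m - idx x.
Proof.
rewrite /idx mirror_val //; have := ltn_ord x; clear -k_odd n_gt1.
by case: (leqP x k.+1) ; do 3?[case: ifP]; lia.
Qed.

(** This is (k + 1)/2 - (u + n - 1) modulo m: the last index of the arc becomes the first. *)
Definition mirror_start u := let a := u + n.-1 in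
  if a <= (k.+1)./2 then (k.+1)./2 - a else
  if a <= (k.+1)./2 + m then (k.+1)./2 + m - a else (k.+1)./2 + m + m - a.

Lemma mirror_chain S u : chain S u -> chain (move_vert (@mirror n k) S) (mirror_start u).
Proof.
move=> [um hS]; split=> [|x].
  by rewrite /mirror_start; clear -um n_gt1 k_odd; do 2?[case: ifP]; lia.
have mirrorK y : mirror (mirror y) = y.
  apply: ord_inj; rewrite !mirror_val //; have := ltn_ord y; clear.
  by do 2?[case: ifP]; lia.
rewrite val_move_vert; last exact: mirror_sym.
rewrite -[x in LHS]mirrorK mem_imset; last by case: (mirror_sym k n_gt1).
rewrite hS mirror_idx /mirror_start /arc; have := idx_lt x; clear -um n_gt1 k_odd.
by do 3?[case: ifP]; lia.
Qed.

End Flips.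

(** * Reduction to the dihedral symmetries *)

Section Normalisation.
Variables n k : nat.
Hypotheses (n_gt1 : 1 < n) (k_mod : k %% 4 = 3).
Local Notation m := (2 * n + k).
Implicit Types (S T : SGvert n k) (gamma delta : SGvert n k -> SGvert n k).

Lemma k_odd_mod4 : odd k.
Proof. by lia. Qed.

Definition aut_path delta := is_automorphism delta /\
  hom_path (@canonical n k) (@canonical n k \o delta).

Lemma aut_comp gamma delta :
  is_automorphism gamma -> is_automorphism delta -> is_automorphism (gamma \o delta).
Proof. by move=> [gb ga] [db da]; split=> [|S T]; [exact: bij_comp|rewrite /= ga da]. Qed.

Lemma aut_path_comp gamma delta : aut_path gamma -> aut_path delta -> aut_path (gamma \o delta).
Proof.
move=> [ga gp] [da dp]; split; first exact: aut_comp.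
exact: hom_path_trans dp (hom_path_aut da gp).
Qed.

Lemma aut_path_rotate : aut_path (@rotate n k).
Proof. by split; [apply: move_vert_aut; apply: ordS_sym|exact: rotate_good]. Qed.

Lemma aut_path_mirror : aut_path (move_vert (@mirror n k)).
Proof. by split; [apply: move_vert_aut; exact: mirror_sym|exact: mirror_good]. Qed.

Lemma rotate_chain_to0 u : u < m -> exists2 delta, aut_path delta &
  forall S v, chain S v -> chain (delta S) (if u <= v then v - u else v + m - u).
Proof.
move=> um; have rot2 := aut_path_comp aut_path_rotate aut_path_rotate.
(* Each double rotation raises every chain start by one; m - u of them bring u to 0. *)
suff iterP j : exists2 delta, aut_path delta & forall S v, j <= m -> chain S v ->
    chain (delta S) (if v + j < m then v + j else v + j - m).
  have [delta good hd] := iterP (m - u); exists delta => // S v hS.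
  have := hd S v (leq_subr u m) hS.
  congr chain; have := hS.1; clear -um; by do 2?[case: ifP]; lia.
elim: j => [|j [delta good hd]].
  have canon_hom : is_hom (@canonical n k) by have [] := hom_path_is_hom aut_path_rotate.2.
  exists id; first by split; [split=> //; exists id|exact: hom_path_refl].
  by move=> S v _ hS; rewrite addn0 hS.1.
exists (@rotate n k \o @rotate n k \o delta); first exact: aut_path_comp.
move=> S v jm hS; have := rotate2_chain n_gt1 k_odd_mod4 (hd S v (ltnW jm) hS).
congr chain; have := hS.1; rewrite /succ_idx; clear -jm; by do 3?[case: ifP]; lia.
Qed.

Lemma automorphism_path gamma : is_automorphism gamma ->
  hom_path (@canonical n k) (@canonical n k \o gamma).
Proof.
have k_odd := k_odd_mod4; have m_gt1 : 1 < m by clear -n_gt1; lia.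
have [S0 hS0] := chain_exists n_gt1 k_odd (ltnW m_gt1).
have [S1 hS1] := chain_exists n_gt1 k_odd m_gt1.
have near01 : near S0 S1.
  by apply: (near_chain_succ n_gt1 k_odd hS0); rewrite /succ_idx m_gt1.
(* The images of chains 0 and 1 are consecutive chains: a rotation suffices if their order is kept,
   otherwise a reflection comes first. *)
move=> ga; have [delta [da dp] [h0 h1]] : exists2 delta, aut_path delta &
    chain (delta (gamma S0)) 0 /\ chain (delta (gamma S1)) 1.
  have [u hu] := rigid_chain n_gt1 k_odd (rigid_aut ga (chain_rigid n_gt1 k_odd hS0)).
  have [v hv] := rigid_chain n_gt1 k_odd (rigid_aut ga (chain_rigid n_gt1 k_odd hS1)).
  have nearg := near_aut ga near01.
  have vsu := near_chain n_gt1 k_odd hu hv nearg.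
  have [delta good hd] := rotate_chain_to0 hu.1.
  have [e|e] := vsu.
    exists delta => //; split.
      by have := hd _ _ hu; rewrite leqnn subnn.
    have := hd _ _ hv; congr chain; rewrite e /succ_idx; have := hu.1; clear -m_gt1.
    by do 2?[case: ifP]; lia.
  have hu' := mirror_chain n_gt1 k_odd hu; have hv' := mirror_chain n_gt1 k_odd hv.
  have [delta' good' hd'] := rotate_chain_to0 hu'.1.
  exists (delta' \o move_vert (@mirror n k)); first exact: aut_path_comp good' aut_path_mirror.
  split; first by have := hd' _ _ hu'; rewrite leqnn subnn.
  have := hd' _ _ hv'; congr chain; rewrite e /mirror_start /succ_idx; have := hv.1.
  by clear -m_gt1 n_gt1 k_odd; do 6?[case: ifP]; lia.
have da' := aut_comp da ga.
have fixed S : delta (gamma S) = S.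
  apply: (fixed_all n_gt1 k_odd da' hS0 _ hS1).
    exact: (chain_uniq h0 hS0).
  exact: (chain_uniq h1 hS1).
(* Since delta undoes gamma, precomposing c ~ c delta with gamma joins c gamma to c. *)
have := hom_path_aut ga dp.
have -> : (@canonical n k \o delta) \o gamma = @canonical n k.
  by apply: functional_extensionality => S; rewrite /= fixed.
exact: hom_path_sym.
Qed.

End Normalisation.

Theorem theorem4p3 (n k : nat) (hk : k %% 4 = 3) (hn : 2 <= n)
    (gamma : SGvert n k -> SGvert n k) (hgamma : is_automorphism gamma) :
  hom_path (@canonical n k) (fun S => @canonical n k (gamma S)).
Proof. exact: automorphism_path. Qed.
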